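(* Let $\mathfrak g$ be a finite-dimensional simple Lie algebra over an algebraically closed field $F$ of characteristic $0$, with Cartan subalgebra $\mathfrak h$, root system $\Delta$ and root spaces $\mathfrak g_\alpha$. Given a partition $\Delta=S_1\sqcup S_2$ into two (nonempty) closed subsets, there exist two (non-unique) subspaces $\mathfrak s_1,\mathfrak s_2\subseteq\mathfrak h$ such that $$\mathfrak g=\Big(\mathfrak s_1\oplus\bigoplus_{\alpha\in S_1}\mathfrak g_\alpha\Big)\oplus\Big(\mathfrak s_2\oplus\bigoplus_{\alpha\in S_2}\mathfrak g_\alpha\Big)$$ is a regular decomposition. Conversely, by forgetting the Cartan part of a $2$-regular decomposition of $\mathfrak g$ (i.e. passing from $\mathfrak g_i=\mathfrak s_i\oplus\bigoplus_{\alpha\in\Delta_i}\mathfrak g_\alpha$ to $\Delta_i$, $i=1,2$) one obtains a partition of $\Delta$ into two closed subsets.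
   Context: A subset $S\subseteq\Delta$ is closed if $\alpha,\beta\in S$ and $\alpha+\beta\in\Delta$ imply $\alpha+\beta\in S$. For $m\ge2$, an $m$-regular decomposition of $\mathfrak g$ is a direct sum decomposition (of vector spaces) $\mathfrak g=\bigoplus_{i=1}^m\mathfrak g_i$ with nonzero summands such that all $\mathfrak g_i$ and all $\mathfrak g_i\oplus\mathfrak g_j$ ($i\ne j$) are Lie subalgebras of $\mathfrak g$, and each $\mathfrak g_i$ has the form $\mathfrak s_i\oplus\bigoplus_{\alpha\in\Delta_i}\mathfrak g_\alpha$ for some subspace $\mathfrak s_i\subseteq\mathfrak h$ and some subset $\Delta_i\subseteq\Delta$. *)

(* Defs.v *)
From HB Require Import structures.
From mathcomp Require Import all_boot all_order all_algebra.
From mathcomp Require Import finmap.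

Set Implicit Arguments.
Unset Strict Implicit.
Unset Printing Implicit Defensive.

Import GRing.Theory.
Local Open Scope ring_scope.

HB.mixin Record Vector_isLie (F : fieldType) L of Vector F L := {
  lie : L -> L -> L;
  lie_linearl : forall z, linear (lie^~ z);
  lie_linearr : forall z, linear (lie z);
  liexx : forall x, lie x x = 0;
  lie_jacobi : forall x y z,
    lie x (lie y z) + lie y (lie z x) + lie z (lie x y) = 0
}.

#[short(type="lieAlgType")]
HB.structure Definition LieAlgebra (F : fieldType) :=
  { L of Vector_isLie F L & Vector F L }.

Notation "[[ x , y ]]" := (lie x y) (at level 0, format "[[ x ,  y ]]").

Section LieDefs.
Variables (F : fieldType) (L : lieAlgType F).
Implicit Types (x y z : L) (U V I H : {vspace L}).

HB.instance Definition _ z := GRing.isSemilinear.Build F L L _ (@lie F L z)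
  (GRing.semilinear_linear (@lie_linearr F L z)).

Definition ad x : 'End(L) := linfun (lie x).

Lemma adE x y : ad x y = [[x, y]].
Proof. by rewrite lfunE. Qed.

Definition is_subalgebra U : Prop :=
  forall x y, x \in U -> y \in U -> [[x, y]] \in U.

Definition is_ideal I : Prop :=
  forall x y, y \in I -> [[x, y]] \in I.

Definition is_simple : Prop :=
  (exists x y, [[x, y]] != 0) /\
  (forall I, is_ideal I -> I = 0%VS \/ I = fullv).

(* The span of all brackets [[u, v]] with u in U and v in V. *)
Definition lie_prod U V : {vspace L} :=
  <<[seq [[u, v]] | u <- vbasis U, v <- vbasis V]>>%VS.

Definition is_nilpotent U : Prop :=
  exists n, iter n (lie_prod U) U = 0%VS.

Definition is_cartan H : Prop :=
  [/\ is_subalgebra H, is_nilpotent H &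
      forall x, (forall h, h \in H -> [[x, h]] \in H) -> x \in H].

End LieDefs.

(* Linear forms on H; the target is F as a one-dimensional space over itself. *)
Notation weight H := 'Hom(subvs_of H, _^o).

Section RootSpaces.
Variables (F : fieldType) (L : lieAlgType F) (H : {vspace L}).
Implicit Types (a : weight H).

(* It suffices to test [h, x] = a(h) x on a basis of H, see root_spaceP. *)
Definition root_space a : {vspace L} :=
  (\bigcap_(e <- vbasis {:subvs_of H})
     passmx.leigenspace (ad (vsval e)) (a e))%VS.

Definition is_root a : bool := (a != 0) && (root_space a != 0%VS).

Lemma lieDl (x y z : L) : [[x + y, z]] = [[x, z]] + [[y, z]].
Proof. by have := lie_linearl z 1 x y; rewrite !scale1r. Qed.

Lemma lie0l (z : L) : [[0, z]] = 0.
Proof. by apply: (@addrI _ [[0, z]]); rewrite -lieDl !addr0. Qed.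

Lemma lieZl c (x z : L) : [[c *: x, z]] = c *: [[x, z]].
Proof. by have := lie_linearl z c x 0; rewrite lie0l !addr0. Qed.

Lemma root_space_basis a (x : L) :
  (x \in root_space a) =
    all (fun e : subvs_of H => [[vsval e, x]] == (a e : F) *: x)
        (vbasis {:subvs_of H}).
Proof.
rewrite /root_space; elim: (tval _) => [|e s IH].
  by rewrite big_nil memvf.
rewrite big_cons memv_cap IH /= memv_ker !lfun_simp.
by rewrite subr_eq0.
Qed.

Lemma root_spaceP a (x : L) :
  reflect (forall h : subvs_of H, [[vsval h, x]] = (a h : F) *: x)
          (x \in root_space a).
Proof.
rewrite root_space_basis; apply: (iffP allP) => [hx h|hx e _]; last exact/eqP.
have hb : h \in <<vbasis {:subvs_of H}>>%VS.
  by rewrite (span_basis (vbasisP _)) memvf.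
rewrite (coord_span hb).
elim/big_rec: _ => [|i u _ IH]; first by rewrite !linear0 lie0l scale0r.
rewrite !linearD !linearZ /= lieDl lieZl IH scalerDl -scalerA.
by rewrite (eqP (hx _ _)) // mem_nth // size_tuple.
Qed.

End RootSpaces.

Section Roots.
Variables (F : closedFieldType) (L : lieAlgType F) (H : {vspace L}).

Definition eigenvalues (f : 'End(L)) : seq F :=
  sval (closed_field_poly_normal
          (char_poly (passmx.mxof (vbasis {:L}) (vbasis {:L}) f))).

Lemma mem_eigenvalues (f : 'End(L)) c :
  passmx.leigenvalue f c -> c \in eigenvalues f.
Proof.
rewrite /passmx.leigenvalue (passmx.leigenspaceE (vbasisP _)).
rewrite passmx.vsof_eq0 ?vbasisP // => hc.
rewrite /eigenvalues; case: closed_field_poly_normal => r /= hr.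
have: eigenvalue (passmx.mxof (vbasis {:L}) (vbasis {:L}) f) c by [].
rewrite eigenvalue_root_char hr rootZ ?root_prod_XsubC //.
by rewrite (monicP (char_poly_monic _)) oner_eq0.
Qed.

(* Finitely many weights among which all roots are found: on each vector of a
   basis of H, a root takes an eigenvalue of the adjoint action. *)
Let n := \dim {:subvs_of H}.
Let b : n.-tuple (subvs_of H) := vbasis {:subvs_of H}.
Let ev : seq F := flatten [seq eigenvalues (ad (vsval e)) | e <- b].

Definition candidate_weights : seq (weight H) :=
  [seq \sum_(i < n) (val (c i) : F) *: linfun (coord b i : _ -> F^o)
     | c : {ffun 'I_n -> seq_sub ev}].

Lemma root_candidate a : is_root a -> a \in candidate_weights.
Proof.
case/andP=> _ an0.
have hev (i : 'I_n) : a b`_i \in ev.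
  apply/flatten_mapP; exists b`_i; first by rewrite mem_nth ?size_tuple.
  apply: mem_eigenvalues; apply: contraNneq an0 => h0.
  rewrite -subv0 -h0; apply/subvP => x /root_spaceP hx.
  by rewrite memv_ker !lfun_simp /= hx subrr.
apply/mapP; exists [ffun i => SeqSub (hev i)]; first by rewrite mem_enum.
apply/lfunP => h; rewrite sum_lfunE.
have hb : h \in <<b>>%VS by rewrite (span_basis (vbasisP _)) memvf.
rewrite {1}(coord_span hb) linear_sum; apply: eq_bigr => i _.
rewrite linearZ /= !lfunE /= lfunE /= ffunE /=.
exact: mulrC.
Qed.

Definition root_system : {fset (weight H)} :=
  [fset a in candidate_weights | is_root a]%fset.

Lemma mem_root_system a : (a \in root_system) = is_root a.
Proof.
rewrite !inE andb_idl //; exact: root_candidate.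
Qed.

End Roots.

Section RegularDecompositions.
Variables (F : closedFieldType) (L : lieAlgType F) (H : {vspace L}).
Implicit Types (S : {fset (weight H)}) (s U : {vspace L}).

Definition closed_roots S : Prop :=
  forall a b, a \in S -> b \in S -> a + b \in root_system H -> a + b \in S.

Definition closed_partition S1 S2 : Prop :=
  [/\ (S1 `|` S2)%fset = root_system H, [disjoint S1 & S2]%fset,
      S1 != fset0 /\ S2 != fset0 &
      closed_roots S1 /\ closed_roots S2].

Definition regular_space s S : {vspace L} :=
  (s + \sum_(a <- S) root_space a)%VS.

(* U is the direct sum of a subspace s of H and the root spaces over S. *)
Definition has_regular_form U s S : Prop :=
  [/\ (s <= H)%VS, (S `<=` root_system H)%fset, U = regular_space s S &
      directv (s + \sum_(a <- S) root_space a)].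

Definition regular_decomposition m (g : 'I_m -> {vspace L}) : Prop :=
  [/\ [/\ (2 <= m)%N, (\sum_i g i)%VS = fullv & directv (\sum_i g i)],
      forall i, g i != 0%VS,
      forall i, is_subalgebra (g i),
      forall i j, i != j -> is_subalgebra (g i + g j)%VS &
      forall i, exists s S, has_regular_form (g i) s S].

(* The spaces s i + \sum_(a <- D i) root_space a, with s i in H and D i a set of
   roots, form a regular decomposition. *)
Definition regular_decomposition_data m
    (s : 'I_m -> {vspace L}) (D : 'I_m -> {fset (weight H)}) : Prop :=
  let g i := regular_space (s i) (D i) in
  regular_decomposition g /\ forall i, has_regular_form (g i) (s i) (D i).

End RegularDecompositions.

(* Main.v *)
(* The classical structure theory is rebuilt from the Cartan subalgebra H. Fitting's
   lemma decomposes L into generalized weight spaces of H, and the weight 0 space is H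
   by Engel's argument. An element [x, y] of H with x, y of opposite weights a, -a has
   trace 0 on every a-string, so all weights take on it rational multiples of the value
   of a; were the Killing form zero, all weights would vanish, so the Killing form is
   nondegenerate. Then H is abelian and acts diagonally, and every root has an
   sl2-triple.

   For a closed partition S1, S2 let h_i be the span of the brackets of opposite root
   spaces in S_i. Roots a, -a in S1 and b, -b in S2 satisfy: a + b is not a root, so h_1
   is killed by b. An element z of h_1 and h_2 acts on each of its eigenspaces by a
   commutator, hence with trace 0, so z = 0. Moreover h_1 + h_2 is not H: the trace on
   the sum of the g_c with c in S1 and -c not in S1 vanishes on h_1 and h_2 but is
   positive on the coroot of any such c, by reflecting along c. Thus s_1 contains h_1,
   s_2 contains h_2, and there is room for two choices. Conversely, [g_a, g_b] is nonzero
   whenever a, b and a + b are roots, which forces the root sets of a 2-regular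
   decomposition to be closed. *)

Require Import Defs.
From HB Require Import structures.
From mathcomp Require Import all_boot all_order all_algebra.
From mathcomp Require Import finmap.
From mathcomp Require Import boolp ring.

Set Implicit Arguments.
Unset Strict Implicit.
Unset Printing Implicit Defensive.

Import GRing.Theory.
Local Open Scope ring_scope.

(** * Traces *)

(* By the rank factorization A = C R, tr A = tr (R C), and R C is nilpotent of smaller
   size. *)
Lemma mxtrace_nilpotent (F : fieldType) n (A : 'M[F]_n) k :
  (forall v : 'rV_n, iter k (mulmxr A) v = 0) -> \tr A = 0.
Proof.
elim/ltn_ind: n A => n IHn A nilA.
have [rA|rA] := eqVneq (\rank A) n; last first.
  have ltr : (\rank A < n)%N by rewrite ltn_neqAle rA rank_leq_col.
  rewrite -{1}(mulmx_base A) mxtrace_mulC; apply: IHn ltr _ _ => w.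
  apply: (row_free_inj (row_base_free A)); rewrite mul0mx.
  have -> m : iter m (mulmxr (row_base A *m col_base A)) w *m row_base A
      = iter m (mulmxr A) (w *m row_base A).
    elim: m => //= m IHm.
    by rewrite -IHm -[X in _ = _ *m X](mulmx_base A) !mulmxA.
  exact: nilA.
have injA : row_free A by apply/eqP.
have v0 (v : 'rV[F]_n) : v = 0.
  have: iter k (mulmxr A) v = 0 by [].
  elim: k {IHn nilA} v => //= k IHk v iter0.
  by apply/IHk/(row_free_inj injA); rewrite mul0mx.
case: n A {IHn nilA rA injA} v0 => [|n] A v0; first by rewrite /mxtrace big_ord0.
by have /rowP/(_ 0) := v0 (const_mx 1); rewrite !mxE => /eqP; rewrite oner_eq0.
Qed.

Section Trace.
Variable F : fieldType.
Implicit Types U V : vectType F.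

Definition ltr V (f : 'End(V)) : F :=
  \tr (passmx.mxof (vbasis {:V}) (vbasis {:V}) f).

Lemma ltr_is_scalar V : scalar (@ltr V).
Proof. by move=> c f g; rewrite /ltr passmx.mxof_linear mxtraceD mxtraceZ. Qed.
HB.instance Definition _ V :=
  GRing.isSemilinear.Build F 'End(V) F _ (@ltr V)
    (GRing.semilinear_linear (@ltr_is_scalar V)).

Lemma ltrC U V (f : 'Hom(U, V)) (g : 'Hom(V, U)) : ltr (f \o g)%VF = ltr (g \o f)%VF.
Proof.
rewrite /ltr (passmx.mxof_comp _ _ (vbasisP {: V})).
by rewrite (passmx.mxof_comp _ _ (vbasisP {: U})) mxtrace_mulC.
Qed.

Lemma ltr1 V : ltr (\1 : 'End(V))%VF = (\dim {:V})%:R.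
Proof.
by rewrite /ltr passmx.mxof1 ?mxtrace1 //; case/andP: (vbasisP {: V}).
Qed.

Lemma ltr_nilpotent V (f : 'End(V)) k : (forall v, iter k f v = 0) -> ltr f = 0.
Proof.
move=> nilf; pose b := vbasis {:V}.
apply: (@mxtrace_nilpotent _ _ _ k) => v.
have -> : iter k (mulmxr (passmx.mxof b b f)) v
    = passmx.rVof b (iter k f (passmx.vecof b v)).
  elim: k {nilf} => [|k IHk] /=; first by rewrite passmx.vecofK // vbasisP.
  by rewrite IHk passmx.mul_mxof passmx.rVofK // vbasisP.
by rewrite nilf; apply/eqP; rewrite passmx.rVof_eq0 // vbasisP.
Qed.

Lemma ltr_proj V (p : 'End(V)) (W : {vspace V}) :
  (forall x, p x \in W) -> {in W, forall x, p x = x} -> ltr p = (\dim W)%:R.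
Proof.
move=> pW pid.
pose i : 'Hom(subvs_of W, V) := linfun (vsval : subvs_of W -> V).
pose q : 'Hom(V, subvs_of W) := linfun (vsproj W).
have -> : p = (i \o (q \o p))%VF.
  by apply/lfunP => x; rewrite !lfun_simp /= vsprojK.
rewrite ltrC.
have -> : ((q \o p) \o i)%VF = \1%VF.
  apply/lfunP => x; rewrite !lfun_simp /=; apply: val_inj.
  by rewrite /= vsprojK // !pid ?subvsP.
by rewrite ltr1 dimvf.
Qed.

End Trace.

Section CharZero.
Variable F : fieldType.
Hypothesis charF : [pchar F] =i pred0.

Lemma natf_eq0 n : (n%:R == 0 :> F) = (n == 0%N).
Proof. by move/pcharf0P: charF => ->. Qed.

Lemma natf_inj m n : m%:R = n%:R :> F -> m = n.
Proof.
have le_inj i j : (i <= j)%N -> i%:R = j%:R :> F -> i = j.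
  move=> le_ij /esym/eqP; rewrite -subr_eq0 -natrB // natf_eq0 subn_eq0 => le_ji.
  by apply/eqP; rewrite eqn_leq le_ij.
by case: (leqP m n) => [/le_inj//|/ltnW/le_inj ji /esym/ji].
Qed.

Lemma intf_inj (i j : int) : i%:~R = j%:~R :> F -> i = j.
Proof.
move/eqP; rewrite -subr_eq0 -intrB => ij0; apply/eqP; rewrite -subr_eq0.
move: ij0; case: (i - j) => n; first by rewrite natf_eq0.
by rewrite NegzE mulrNz oppr_eq0 natf_eq0.
Qed.

End CharZero.

(** * Generalized eigenvectors *)

Section Iteration.
Variables (F : fieldType) (V : vectType F).
Implicit Types (f g : 'End(V)) (U W : {vspace V}).

Definition lpow f n : 'End(V) := iter n (fun g => f \o g)%VF \1%VF.

Lemma lpowE f n x : lpow f n x = iter n f x.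
Proof. by elim: n => [|n IHn] /=; rewrite lfunE //= IHn. Qed.

Lemma iter_lfun0 f n : iter n f 0 = 0.
Proof. by rewrite -lpowE linear0. Qed.

Lemma iter_lfunP f n c x y :
  iter n f (x + c *: y) = iter n f x + c *: iter n f y.
Proof. by rewrite -!lpowE linearD linearZ. Qed.

Lemma iter_lfun_leq f m n x : (m <= n)%N -> iter m f x = 0 -> iter n f x = 0.
Proof. by move=> /subnK <- fx0; rewrite iterD fx0 iter_lfun0. Qed.

Lemma iter_mem f U n x :
  {in U, forall y, f y \in U} -> x \in U -> iter n f x \in U.
Proof. by move=> Uf Ux; elim: n => //= n IHn; apply: Uf. Qed.

Lemma lpowS_img f U n : (lpow f n.+1 @: U = f @: (lpow f n @: U))%VS.
Proof. by rewrite -limg_comp. Qed.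

Lemma lpow_img_stab f U : {in U, forall y, f y \in U} ->
  exists n, forall m, (n <= m)%N -> (lpow f m @: U = lpow f n @: U)%VS.
Proof.
move=> Uf; suff [n nP] : exists n, (lpow f n.+1 @: U = lpow f n @: U)%VS.
  exists n => m /subnK <-; elim: (m - n)%N => // k IHk.
  by rewrite addSn lpowS_img IHk -lpowS_img.
have decr n : (lpow f n.+1 @: U <= lpow f n @: U)%VS.
  apply/subvP => _ /memv_imgP[x Ux ->].
  by rewrite lpowE iterSr -lpowE memv_img // Uf.
suff {Uf} H d : forall n, (\dim (lpow f n @: U) < d)%N ->
    exists m, (lpow f m.+1 @: U = lpow f m @: U)%VS by apply: (H _ 0%N (leqnn _)).
elim: d => // d IHd n dim_n.
have [eqn|neqn] := eqVneq (lpow f n.+1 @: U)%VS (lpow f n @: U)%VS.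
  by exists n.
apply: (IHd n.+1); have /leqifP := dimv_leqif_eq (decr n).
by rewrite (negPf neqn) => /leq_trans; apply.
Qed.

Lemma fitting f U : {in U, forall y, f y \in U} ->
  exists n, (U = (U :&: lker (lpow f n.+1)) + lpow f n.+1 @: U)%VS /\
    forall m, (n < m)%N -> (lpow f m @: U = lpow f n.+1 @: U)%VS
      /\ (U :&: lker (lpow f m) = U :&: lker (lpow f n.+1))%VS.
Proof.
move=> Uf; have [n0 imn0] := lpow_img_stab Uf; exists n0.
have {imn0}imn m : (n0 < m)%N -> (lpow f m @: U = lpow f n0.+1 @: U)%VS.
  by move=> lt_n0m; rewrite !imn0 // ltnW.
move: {n0}n0.+1 imn => n imn.
have sub_ker m : (n <= m)%N ->
    (U :&: lker (lpow f n) <= U :&: lker (lpow f m))%VS.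
  move=> le_nm; apply/subvP => x; rewrite !memv_cap !memv_ker !lpowE.
  by case/andP=> -> /eqP/(iter_lfun_leq le_nm)->; rewrite eqxx.
have imU : (lpow f n @: U <= U)%VS.
  by apply/subvP => _ /memv_imgP[x Ux ->]; rewrite lpowE iter_mem.
split=> [|m le_nm]; last first.
  split; first exact: imn.
  apply/esym/eqP; rewrite eqEdim sub_ker //=.
  have := limg_ker_dim (lpow f n) U; rewrite -(imn m le_nm).
  by rewrite -(limg_ker_dim (lpow f m) U) => /addIn->.
apply/esym/eqP; rewrite eqEsubv subv_add capvSl imU /=.
apply/subvP => x Ux; have: lpow f n x \in (lpow f (n + n) @: U)%VS.
  by rewrite imn ?leq_addr // memv_img.
case/memv_imgP=> y Uy xy; rewrite -[x](subrK (lpow f n y)) memv_add ?memv_img //.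
rewrite memv_cap memvB //=; last by rewrite lpowE iter_mem.
by rewrite memv_ker linearB /= xy !lpowE iterD subrr.
Qed.

Lemma iter_comp_proj f (p : 'End(V)) U n x :
    {in U, forall y, f y \in U} -> (forall y, p y \in U) ->
    {in U, forall y, p y = y} ->
  iter n.+1 (f \o p)%VF x = iter n.+1 f (p x).
Proof.
move=> Uf Up pU; elim: n => [|n IHn]; first by rewrite /= lfunE.
by rewrite iterS IHn lfunE /= pU // Uf // iter_mem.
Qed.

End Iteration.

Lemma ltr_nilpotent_proj (F : fieldType) (V : vectType F) (f p : 'End(V))
    (U : {vspace V}) n :
    (forall x, p x \in U) -> {in U, forall x, p x = x} ->
    {in U, forall y, f y \in U} -> {in U, forall y, iter n f y = 0} ->
  ltr (f \o p)%VF = 0.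
Proof.
move=> pU pid fU nilf; apply: (@ltr_nilpotent _ _ _ n.+1) => v.
by rewrite (iter_comp_proj _ _ fU) // (iter_lfun_leq (leqnSn n)) ?nilf.
Qed.

Lemma eigenvector_in (F : closedFieldType) (V : vectType F) (f : 'End(V))
    (U : {vspace V}) :
  {in U, forall y, f y \in U} -> U != 0%VS ->
  exists c, exists2 x, x \in U & x != 0 /\ f x = c *: x.
Proof.
move=> Uf U0.
pose g : 'End(subvs_of U) := linfun (vsproj U \o f \o (vsval : subvs_of U -> V)).
pose b := vbasis {: subvs_of U}.
have /closed_rootP[c] : size (char_poly (passmx.mxof b b g)) != 1%N.
  by rewrite size_char_poly dimvf /dim /= eqSS dimv_eq0.
rewrite -eigenvalue_root_char /eigenvalue -(passmx.vsof_eq0 (vbasisP _)).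
rewrite -(passmx.leigenspaceE (vbasisP _)) -vpick0; set x := vpick _ => x0.
have: x \in passmx.leigenspace g c by apply: memv_pick.
rewrite memv_ker !lfun_simp /= subr_eq0 => /eqP gx.
exists c, (vsval x); first exact: subvsP.
split=> //.
by rewrite -[f _](@vsprojK _ _ U) ?Uf ?subvsP // gx.
Qed.

Section LieBasics.
Variables (F : fieldType) (L : lieAlgType F).
Implicit Types (x y z h : L).

Lemma lie0r x : [[x, 0]] = 0. Proof. exact: linear0. Qed.
Lemma lieDr x y z : [[x, y + z]] = [[x, y]] + [[x, z]]. Proof. exact: linearD. Qed.
Lemma lieZr c x y : [[x, c *: y]] = c *: [[x, y]]. Proof. exact: linearZ. Qed.
Lemma lieNr x y : [[x, - y]] = - [[x, y]]. Proof. exact: linearN. Qed.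
Lemma lieNl x y : [[- x, y]] = - [[x, y]].
Proof. by rewrite -scaleN1r lieZl scaleN1r. Qed.
Lemma lie_sumr I r (P : pred I) x (y : I -> L) :
  [[x, \sum_(i <- r | P i) y i]] = \sum_(i <- r | P i) [[x, y i]].
Proof. exact: linear_sum. Qed.

Lemma lie_anti x y : [[x, y]] = - [[y, x]].
Proof.
have := liexx (x + y); rewrite lieDl !lieDr !liexx add0r addr0.
by move/eqP; rewrite addr_eq0 => /eqP.
Qed.

Lemma lie_suml I r (P : pred I) x (y : I -> L) :
  [[\sum_(i <- r | P i) y i, x]] = \sum_(i <- r | P i) [[y i, x]].
Proof.
rewrite lie_anti lie_sumr -sumrN; apply: eq_bigr => i _; exact/esym/lie_anti.
Qed.

Lemma lie_der x y z : [[x, [[y, z]]]] = [[[[x, y]], z]] + [[y, [[x, z]]]].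
Proof.
have /eqP := lie_jacobi x y z; rewrite -addrA addr_eq0 => /eqP ->.
by rewrite opprD addrC -lie_anti -lieNr -lie_anti.
Qed.

Definition ad_shift h c : 'End(L) := (ad h - c *: \1)%VF.

Lemma ad_shiftE h c x : ad_shift h c x = [[h, x]] - c *: x.
Proof. by rewrite !lfun_simp. Qed.

Definition gvec h c x := exists n, iter n (ad_shift h c) x = 0.

Lemma gvec0 h c : gvec h c 0. Proof. by exists 0%N. Qed.

Lemma gvecD h c x y : gvec h c x -> gvec h c y -> gvec h c (x + y).
Proof.
move=> [m xm] [n yn]; exists (maxn m n).
rewrite -lpowE linearD /= !lpowE (iter_lfun_leq (leq_maxl m n) xm).
by rewrite (iter_lfun_leq (leq_maxr m n) yn) addr0.
Qed.

Lemma gvecZ h c d x : gvec h c x -> gvec h c (d *: x).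
Proof. by case=> n xn; exists n; rewrite -lpowE linearZ /= lpowE xn scaler0. Qed.

Lemma ad_shift_lie h c d x y :
  ad_shift h (c + d) [[x, y]] = [[ad_shift h c x, y]] + [[x, ad_shift h d y]].
Proof.
rewrite !ad_shiftE lie_der lieDl lieDr lieNl lieNr lieZl lieZr scalerDl opprD.
by rewrite addrACA.
Qed.

Lemma iter_ad_shift_lie h c d x y m n :
    iter m (ad_shift h c) x = 0 -> iter n (ad_shift h d) y = 0 ->
  iter (m + n) (ad_shift h (c + d)) [[x, y]] = 0.
Proof.
move: {-1}(m + n)%N (erefl (m + n)%N) => k; elim: k m n x y => [|k IHk] m n x y.
  by case: m n => [|//] [|//] _ /= ->; rewrite lie0l.
case: m => [_ /= -> _|m].
  by rewrite lie0l -[LHS]/(iter k.+1 _ 0) iter_lfun0.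
case: n => [_ _ /= ->|n km xm yn].
  by rewrite lie0r -[LHS]/(iter k.+1 _ 0) iter_lfun0.
rewrite iterSr ad_shift_lie -lpowE linearD /= !lpowE.
rewrite (IHk m n.+1) ?(IHk m.+1 n) ?addr0 -?iterSr //.
- by move: km; rewrite addnS => -[].
- by move: km; rewrite addSn => -[].
Qed.

Lemma gvec_lie h c d x y :
  gvec h c x -> gvec h d y -> gvec h (c + d) [[x, y]].
Proof.
move=> [m xm] [n yn]; exists (m + n)%N; exact: iter_ad_shift_lie.
Qed.

Lemma gvec_uniq h c d x : gvec h c x -> gvec h d x -> c != d -> x = 0.
Proof.
move=> [m xm] [n yn] ncd; move: {-1}(m + n)%N (erefl (m + n)%N) => k.
elim: k m n x xm yn => [|k IHk] m n x; first by case: m n => [|//] [|//] /= ->.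
case: m => [//|m]; case: n => [//|n] xm xn kmn.
have comm (i : nat) a b : iter i (ad_shift h a) (ad_shift h b x)
    = ad_shift h b (iter i (ad_shift h a) x).
  elim: i => //= i ->; rewrite !ad_shiftE.
  rewrite !lieDr !lieNr !lieZr !scalerDr !scalerN !scalerA (mulrC a b).
  by rewrite !opprD !opprK !addrA [X in X + _]addrAC.
have x1 : ad_shift h c x = 0.
  apply: (IHk m n.+1); rewrite -?iterSr ?comm ?xn ?linear0 //.
  by move: kmn; rewrite addSn => -[].
have x2 : ad_shift h d x = 0.
  apply: (IHk m.+1 n); rewrite -?iterSr ?comm ?xm ?linear0 //.
  by move: kmn; rewrite addnS => -[].
have : (c - d) *: x = 0.
  have := x2; rewrite -[RHS]x1 !ad_shiftE => /addrI/oppr_inj e.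
  by rewrite scalerBl e subrr.
by move/eqP; rewrite scaler_eq0 subr_eq0 (negPf ncd) => /eqP.
Qed.

End LieBasics.

Section WeightDecomposition.
Variables (F : closedFieldType) (L : lieAlgType F) (H : {vspace L}).
Hypothesis charF : [pchar F] =i pred0.
Implicit Types (V : {vspace L}) (h x y z : L) (c : F).
Hypothesis nilH : forall h h', h \in H -> h' \in H -> gvec h 0 h'.

Hypothesis subH : is_subalgebra H.

Definition stable (V : {vspace L}) :=
  forall h x : L, h \in H -> x \in V -> [[h, x]] \in V.

Lemma stable_shift V h c : h \in H -> stable V ->
  {in V, forall y, ad_shift h c y \in V}.
Proof. by move=> Hh sV y Vy; rewrite ad_shiftE memvB ?memvZ ?sV. Qed.

Lemma lie_ad_shift h c h' w :
  [[h', ad_shift h c w]] = ad_shift h c [[h', w]] - [[ad_shift h 0 h', w]].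
Proof.
rewrite !ad_shiftE scale0r subr0 lieDr lieNr lieZr (lie_der h h').
by rewrite addrAC [X in X - _ - _]addrC addrK.
Qed.

Lemma lie_iter_shift V h c k m h' x : stable V -> h \in H -> h' \in H ->
    iter k (ad_shift h 0) h' = 0 -> x \in V ->
  exists2 y, y \in V &
    [[h', iter (m + k) (ad_shift h c) x]] = iter m (ad_shift h c) y.
Proof.
move=> sV Hh; elim: k m h' x => [|k IHk] m h' x.
  by move=> _ /= -> _; exists 0; rewrite ?mem0v // lie0l iter_lfun0.
move=> Hh' kh' Vx; elim: m => [|m [y Vy IHm] ].
  by eexists; last reflexivity; rewrite sV // iter_mem //; apply: stable_shift.
have Hh'' : ad_shift h 0 h' \in H.
  by rewrite ad_shiftE scale0r subr0 subH.
have [|z Vz] := IHk m.+1 _ x Hh'' _ Vx; first by rewrite -iterSr.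
rewrite addSnnS => zE; exists (y - z); first exact: memvB.
rewrite addSn iterS lie_ad_shift IHm zE -[in RHS]lpowE linearB /=.
by rewrite !comp_lfunE !lpowE.
Qed.

Lemma iter_shift_split V h c : stable V -> h \in H ->
  exists n V1 V2, [/\ V = (V1 + V2)%VS,
    V1 = (V :&: lker (lpow (ad_shift h c) n.+1))%VS,
    V2 = (lpow (ad_shift h c) n.+1 @: V)%VS, stable V1 & stable V2].
Proof.
move=> sV Hh; have [n [defV nP] ] := fitting (stable_shift c Hh sV).
exists n; set V1 := (V :&: _)%VS in defV nP *; set V2 := (_ @: V)%VS in defV nP *.
exists V1, V2; split=> // h' x Hh'.
  have [k kh'] := nilH Hh Hh'.
  rewrite memv_cap => /andP[Vx]; rewrite memv_ker lpowE => /eqP nx.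
  have [_ <-] := nP _ (leq_addl k n.+1).
  rewrite memv_cap sV // memv_ker lpowE -[c]add0r.
  by rewrite (iter_ad_shift_lie kh' nx) eqxx.
have [k kh'] := nilH Hh Hh'; have [imE _] := nP _ (leq_addr k n.+1).
rewrite -{1}/V2 -{1}imE => /memv_imgP[y Vy ->].
have [z Vz] := lie_iter_shift c n.+1 sV Hh Hh' kh' Vy.
by rewrite lpowE => ->; rewrite -lpowE memv_img.
Qed.

Definition gen (a : weight H) x :=
  forall h : subvs_of H, gvec (vsval h) (a h) x.

Lemma single_weight V : V != 0%VS -> stable V ->
    (forall h, h \in H -> exists c n, {in V, forall x, iter n (ad_shift h c) x = 0}) ->
  exists a : weight H, {in V, forall x, gen a x}.
Proof.
move=> V0 sV nilV.
have d0 : (\dim V)%:R != 0 :> F by rewrite (natf_eq0 charF) dimv_eq0.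
pose phi (h : subvs_of H) : F^o := ltr (ad (vsval h) \o projv V)%VF / (\dim V)%:R.
have phi_lin : linear phi; rewrite /phi.
  move=> c h h'; have -> : (ad (vsval (c *: h + h')) \o projv V)%VF
      = c *: (ad (vsval h) \o projv V)%VF + (ad (vsval h') \o projv V)%VF.
    by apply/lfunP => x; rewrite !lfun_simp /= lieDl lieZl.
  by rewrite linearP mulrDl -mulrA.
pose phiL := GRing.isSemilinear.Build F _ _ _ phi
    (GRing.semilinear_linear phi_lin).
pose phi' : {linear subvs_of H -> F^o} := HB.pack phi phiL.
exists (linfun phi') => x Vx h; rewrite lfunE /=.
have [c [n nil] ] := nilV _ (subvsP h).
suff -> : phi h = c by exists n; apply: nil.
have: ltr (ad_shift (vsval h) c \o projv V)%VF = 0.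
  apply: (ltr_nilpotent_proj (@memv_proj _ _ V) (@projv_id _ _ V) _ nil).
  exact: stable_shift (subvsP h) sV.
rewrite /ad_shift comp_lfunDl comp_lfunNl -comp_lfunZl comp_lfun1l.
rewrite linearB linearZ /= (ltr_proj (@memv_proj _ _ V)) => [|y]; last exact: projv_id.
by rewrite /phi => /eqP; rewrite subr_eq0 => /eqP->; rewrite mulfK.
Qed.

Lemma weight_decomposition V : stable V ->
  exists s : seq (weight H * {vspace L}), V = (\sum_(p <- s) p.2)%VS /\
    forall p, p \in s -> {in p.2, forall x, gen p.1 x}.
Proof.
have [d] := ubnP (\dim V); elim: d V => // d IHd V dimV sV.
have [->|V0] := eqVneq V 0%VS; first by exists [::]; rewrite big_nil.
have [nilV|] := EM (forall h, h \in H ->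
    exists c n, {in V, forall x, iter n (ad_shift h c) x = 0}).
  have [a aP] := single_weight V0 sV nilV.
  exists [:: (a, V)]; rewrite big_seq1; split=> // p.
  by rewrite inE => /eqP->.
move=> /existsNP[h /not_implyP[Hh nh] ].
have [|c [x Vx [x0 hx] ] ] := @eigenvector_in _ _ (ad h) V _ V0.
  by move=> y Vy; rewrite adE sV.
have [n [V1 [V2 [defV defV1 defV2 sV1 sV2] ] ] ] := iter_shift_split c sV Hh.
have dimS := limg_ker_dim (lpow (ad_shift h c) n.+1) V.
rewrite -defV1 -defV2 in dimS.
have V1_gt0 : (0 < \dim V1)%N.
  rewrite lt0n dimv_eq0; apply: contraNneq x0 => V10.
  rewrite -memv0 -V10 defV1 memv_cap Vx memv_ker lpowE iterSr ad_shiftE -adE hx.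
  by rewrite subrr iter_lfun0 eqxx.
have V2_gt0 : (0 < \dim V2)%N.
  rewrite lt0n dimv_eq0; apply/eqP => V20; apply: nh; exists c, n.+1 => y Vy.
  by apply/eqP; rewrite -lpowE -memv0 -V20 defV2 memv_img.
have ltV1 : (\dim V1 < \dim V)%N by rewrite -dimS -{1}[\dim V1]addn0 ltn_add2l.
have ltV2 : (\dim V2 < \dim V)%N by rewrite -dimS -{1}[\dim V2]add0n ltn_add2r.
have [|s1 [defs1 s1P] ] := IHd V1 _ sV1.
  exact: leq_trans ltV1 _.
have [|s2 [defs2 s2P] ] := IHd V2 _ sV2.
  exact: leq_trans ltV2 _.
exists (s1 ++ s2); split=> [|p]; first by rewrite big_cat defV defs1 defs2.
by rewrite mem_cat => /orP[/s1P|/s2P].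
Qed.

End WeightDecomposition.

Lemma uniform_nil (F : fieldType) (V : vectType F) (f : 'End(V)) (U : {vspace V}) :
  {in U, forall y, exists n, iter n f y = 0} ->
  exists n, {in U, forall y, iter n f y = 0}.
Proof.
move=> nilf; suff [n nP] : exists n, forall y, y \in (vbasis U : seq V) -> iter n f y = 0.
  exists n => y /coord_vbasis->; rewrite -lpowE linear_sum big1 // => i _.
  by rewrite linearZ /= lpowE nP ?scaler0 // mem_nth ?size_tuple.
have: {subset (vbasis U : seq V) <= U} by move=> y /vbasis_mem.
elim: (vbasis U : seq V) => [|y s IHs] ysU; first by exists 0%N.
have [|n nP] := IHs; first by move=> z sz; rewrite ysU // inE sz orbT.
have [m my] := nilf y (ysU _ (mem_head _ _)).
exists (maxn m n) => z; rewrite inE => /predU1P[->|/nP zn].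
  exact: iter_lfun_leq (leq_maxl m n) my.
exact: iter_lfun_leq (leq_maxr m n) zn.
Qed.

(** * Projections attached to a direct sum *)

Lemma big_pred1_uniq (R : Type) (idx : R) (op : Monoid.law idx) (I : eqType)
    (r : seq I) i (f : I -> R) :
  uniq r -> i \in r -> \big[op/idx]_(j <- r | j == i) f j = f i.
Proof.
by move=> ur ri; rewrite -big_filter (filter_pred1_uniq ur ri) big_seq1.
Qed.

Lemma sum_delta_uniq (V : nmodType) (I : eqType) (r : seq I) i (x : V) :
  uniq r -> i \in r -> \sum_(j <- r) (if j == i then x else 0) = x.
Proof. by move=> ur ri; rewrite -big_mkcond big_pred1_uniq. Qed.

Section Grading.
Variables (F : fieldType) (V : vectType F) (T : eqType).
Variables (A : seq T) (G : T -> {vspace V}).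
Implicit Types (a b : T) (P : pred T) (x : V) (f g : 'End(V)).

Hypothesis uniqA : uniq A.
Hypothesis fullA : (\sum_(a <- A) G a)%VS = fullv.
Hypothesis indepA : forall x : T -> V, {in A, forall a, x a \in G a} ->
  \sum_(a <- A) x a = 0 -> {in A, forall a, x a = 0}.

Definition gproj1 a : 'End(V) := sumv_pi_for (esym fullA) a.

Lemma gproj1_mem a x : gproj1 a x \in G a.
Proof. exact: memv_sum_pi. Qed.

Lemma gproj1_sum x : \sum_(a <- A) gproj1 a x = x.
Proof. by apply: sumv_pi_uniq_sum; rewrite ?memvf // filter_uniq. Qed.

Lemma gproj1_delta a b x : a \in A -> b \in A -> x \in G b ->
  gproj1 a x = if a == b then x else 0.
Proof.
move=> Aa Ab Gx; apply/eqP; rewrite -subr_eq0; apply/eqP.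
pose y c := gproj1 c x - (if c == b then x else 0).
apply: (indepA (x := y)) => // [c Ac|].
  rewrite /y memvB ?gproj1_mem //; case: eqP => [->//|_]; exact: mem0v.
by rewrite /y sumrB gproj1_sum sum_delta_uniq // subrr.
Qed.

Definition gproj P : 'End(V) := \sum_(a <- A | P a) gproj1 a.
Definition gpart P : {vspace V} := (\sum_(a <- A | P a) G a)%VS.

Lemma gproj_mem P x : gproj P x \in gpart P.
Proof.
rewrite sum_lfunE /gpart; elim/big_rec2: _ => [|a U y _ yU]; first exact: mem0v.
by rewrite memv_add ?gproj1_mem.
Qed.

Lemma gpart_ind P (Q : V -> Prop) :
    Q 0 -> (forall x y, Q x -> Q y -> Q (x + y)) ->
    (forall a x, a \in A -> P a -> x \in G a -> Q x) ->
  forall x, x \in gpart P -> Q x.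
Proof.
move=> Q0 QD QG; rewrite /gpart big_seq_cond.
elim/big_rec: _ => [|a U /andP[Aa Pa] IH] x.
  by rewrite memv0 => /eqP->.
by case/memv_addP=> y Gy [z /IH Qz ->]; apply: QD => //; apply: QG Gy.
Qed.

Lemma gproj_homog P a x : a \in A -> x \in G a ->
  gproj P x = if P a then x else 0.
Proof.
move=> Aa Gx; rewrite sum_lfunE big_mkcond /=.
rewrite (eq_big_seq (fun b => if b == a then if P b then x else 0 else 0)).
  by rewrite -big_mkcond big_pred1_uniq.
by move=> b Ab /=; rewrite (gproj1_delta Ab Aa Gx); case: ifP; case: ifP.
Qed.

Lemma gproj_id P : {in gpart P, forall x, gproj P x = x}.
Proof.
apply: gpart_ind => [|x y xE yE|a x Aa Pa Gx]; first exact: linear0.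
  by rewrite linearD /= xE yE.
by rewrite (gproj_homog P Aa Gx) Pa.
Qed.

Lemma gpart1 a : a \in A -> gpart (pred1 a) = G a.
Proof. by move=> Aa; rewrite /gpart big_pred1_uniq. Qed.

Lemma gpart_sub P a : a \in A -> P a -> (G a <= gpart P)%VS.
Proof. by move=> Aa Pa; rewrite /gpart (big_rem a Aa) Pa addvSl. Qed.

Lemma gpart_mono P (Q : pred T) :
  (forall a, a \in A -> P a -> Q a) -> (gpart P <= gpart Q)%VS.
Proof.
move=> PQ; apply/subvP; apply: gpart_ind => [|x y|a x Aa Pa].
- exact: mem0v.
- exact: memvD.
- exact: (subvP (gpart_sub Aa (PQ a Aa Pa))).
Qed.

Lemma gpart_stable P f :
    (forall a x, a \in A -> P a -> x \in G a -> f x \in gpart P) ->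
  {in gpart P, forall x, f x \in gpart P}.
Proof.
move=> fP; apply: gpart_ind => [|x y xE yE|a x Aa Pa Gx].
- by rewrite linear0 mem0v.
- by rewrite linearD memvD.
- exact: fP Gx.
Qed.

Lemma gpart_predT : gpart xpredT = fullv.
Proof. exact: fullA. Qed.

Lemma gproj_predT : gproj xpredT = \1%VF.
Proof. by apply/lfunP => x; rewrite gproj_id ?gpart_predT ?memvf // lfunE. Qed.

Lemma gpart_capv P (Q : pred T) : (forall a, a \in A -> P a -> Q a -> False) ->
  (gpart P :&: gpart Q = 0)%VS.
Proof.
move=> PQ; have QP0 : forall x, x \in gpart Q -> gproj P x = 0.
  apply: gpart_ind => [|x y xE yE|a x Aa Qa Gx]; first exact: linear0.
    by rewrite linearD /= xE yE addr0.
  by rewrite (gproj_homog P Aa Gx); case: ifP => // Pa; case: (PQ a).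
apply/eqP; rewrite -subv0; apply/subvP => x.
by rewrite memv_cap memv0 => /andP[Px Qx]; rewrite -(gproj_id Px) QP0.
Qed.

Lemma gpart_dim P : \dim (gpart P) = (\sum_(a <- A | P a) \dim (G a))%N.
Proof.
have suf s : uniq s -> {subset s <= A} ->
    \dim (\sum_(a <- s) G a)%VS = (\sum_(a <- s) \dim (G a))%N.
  have gpartE r : uniq r -> {subset r <= A} -> (\sum_(a <- r) G a)%VS = gpart (mem r).
    move=> ur rA; rewrite /gpart -[RHS]big_filter; apply: perm_big.
    apply: uniq_perm; rewrite ?filter_uniq // => a; rewrite mem_filter /=.
    by case ra: (a \in r); rewrite //= (rA _ ra).
  elim: s => [|a s IHs]; first by rewrite !big_nil dimv0.
  move=> /= /andP[nsa us] sA; have As : {subset s <= A}.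
    by move=> b sb; rewrite sA // inE sb orbT.
  have Aa : a \in A by rewrite sA ?mem_head.
  rewrite !big_cons -IHs // dimv_disjoint_sum //.
  rewrite -gpart1 // gpartE //; apply: gpart_capv => b _ /eqP-> /=.
  by rewrite (negPf nsa).
rewrite /gpart -[in LHS]big_filter suf ?big_filter ?filter_uniq // => a.
by rewrite mem_filter => /andP[].
Qed.

Lemma ltr_gproj f P (c : T -> F) :
    (forall a, a \in A -> P a -> {in G a, forall x, f x \in G a}) ->
    (forall a, a \in A -> P a -> {in G a, forall x, exists n,
       iter n (f - c a *: \1)%VF x = 0}) ->
  ltr (f \o gproj P)%VF = \sum_(a <- A | P a) c a * (\dim (G a))%:R.
Proof.
move=> fG nilf.
have -> : (f \o gproj P)%VF = \sum_(a <- A | P a) (f \o gproj1 a)%VF.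
  apply/lfunP => x; rewrite lfunE /= !sum_lfunE linear_sum.
  by apply: eq_bigr => a _; rewrite lfunE.
rewrite linear_sum /= big_seq_cond [RHS]big_seq_cond.
apply: eq_bigr => a /andP[Aa Pa].
have pid : {in G a, forall x, gproj1 a x = x}.
  by move=> x Gx; rewrite (gproj1_delta Aa Aa Gx) eqxx.
have [n nP] := uniform_nil (nilf a Aa Pa).
have: ltr ((f - c a *: \1) \o gproj1 a)%VF = 0.
  apply: ltr_nilpotent_proj (gproj1_mem a) pid _ nP => x Gx.
  by rewrite !lfun_simp memvB ?memvZ // (fG a).
rewrite comp_lfunDl comp_lfunNl -comp_lfunZl comp_lfun1l linearB linearZ /=.
by rewrite (ltr_proj (gproj1_mem a) pid) => /eqP; rewrite subr_eq0 => /eqP.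
Qed.

Lemma ltr_offdiag f :
    (forall a x, a \in A -> x \in G a -> f x \in gpart (predC1 a)) -> ltr f = 0.
Proof.
move=> fP; have -> : f = \sum_(a <- A) (gproj1 a \o f)%VF.
  by apply/lfunP => x; rewrite sum_lfunE -[LHS]gproj1_sum; apply: eq_bigr => a _; rewrite lfunE.
rewrite linear_sum big_seq big1 //= => a Aa.
have -> : gproj1 a = (gproj1 a \o gproj1 a)%VF.
  by apply/lfunP => x; rewrite lfunE /= (gproj1_delta Aa Aa (gproj1_mem a x)) eqxx.
rewrite -comp_lfunA ltrC; set g := (_ \o _)%VF; suff -> : g = 0 by rewrite linear0.
apply/lfunP => x; rewrite !lfunE /= lfunE /=.
move: (f _) (fP a _ Aa (gproj1_mem a x)) => {x}.
apply: gpart_ind => [|y z yE zE|b y Ab /= ba Gy].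
- by rewrite linear0.
- by rewrite linearD /= yE zE addr0.
by rewrite (gproj1_delta Aa Ab Gy) eq_sym (negPf ba).
Qed.

End Grading.

Lemma independent_mem (F : fieldType) (V : vectType F) (T : eqType)
    (A : seq T) (G : T -> {vspace V}) (Q : T -> V -> Prop) :
    uniq A -> (\sum_(a <- A) G a)%VS = fullv ->
    (forall a x, x \in G a -> Q a x) ->
    (forall a x y, Q a x -> Q a y -> Q a (x - y)) ->
    (forall (B : seq T) (x : T -> V), uniq B -> {in B, forall a, Q a (x a)} ->
       \sum_(a <- B) x a = 0 -> {in B, forall a, x a = 0}) ->
  forall a x, Q a x -> x \in G a.
Proof.
move=> uA sumA GQ QB Qind a x Qx.
have Q0 c : Q c 0 by apply/GQ/mem0v.
have pQ c : Q c (gproj1 sumA c x) by apply/GQ/gproj1_mem.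
have [Aa|nAa] := boolP (a \in A).
  pose y c := gproj1 sumA c x - (if c == a then x else 0).
  suff /eqP : y a = 0 by rewrite /y eqxx subr_eq0 => /eqP<-; apply: gproj1_mem.
  apply: (Qind A) => // [c Ac|]; first by apply: QB => //; case: eqP => [->|_].
  by rewrite /y sumrB gproj1_sum // sum_delta_uniq // subrr.
pose y c := if c == a then - x else gproj1 sumA c x.
suff /eqP : y a = 0 by rewrite /y eqxx oppr_eq0 => /eqP->; apply: mem0v.
apply: (Qind (a :: A)) => [|c _||]; rewrite /= ?nAa ?mem_head //.
  by rewrite /y; case: eqP => [->|//]; rewrite -sub0r; apply: QB.
rewrite big_cons {1}/y eqxx -[in - x](gproj1_sum uA sumA x) addrC; apply/eqP.
rewrite subr_eq0; apply/eqP; apply: eq_big_seq => c Ac; rewrite /y.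
by case: eqP => // ca; rewrite -ca Ac in nAa.
Qed.

(** * The weight decomposition of a Cartan subalgebra *)

Section LieProd.
Variables (F : fieldType) (L : lieAlgType F).
Implicit Types (U V W : {vspace L}) (x y : L).

Lemma lie_bilinear_ind U V W :
    (forall i j, (i < \dim U)%N -> (j < \dim V)%N ->
       [[(vbasis U)`_i, (vbasis V)`_j]] \in W) ->
  forall x y, x \in U -> y \in V -> [[x, y]] \in W.
Proof.
move=> bW x y /coord_vbasis-> /coord_vbasis->; rewrite lie_suml rpred_sum // => i _.
rewrite lieZl lie_sumr memvZ // rpred_sum // => j _.
by rewrite lieZr memvZ // bW.
Qed.

Lemma mem_lie_prod U V x y : x \in U -> y \in V -> [[x, y]] \in lie_prod U V.
Proof.
apply: lie_bilinear_ind => i j iU jV; apply: memv_span; apply: allpairs_f.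
  by rewrite mem_nth // size_tuple.
by rewrite mem_nth // size_tuple.
Qed.

Lemma lie_prod_sub U V W :
  (forall x y, x \in U -> y \in V -> [[x, y]] \in W) -> (lie_prod U V <= W)%VS.
Proof.
move=> UVW; apply/span_subvP => _ /allpairsP[ [x y] [/= Ux Vy ->] ].
by rewrite UVW // vbasis_mem.
Qed.

End LieProd.

Section CartanDecomposition.
Variables (F : closedFieldType) (L : lieAlgType F) (H : {vspace L}).
Implicit Types (U V W : {vspace L}) (x y z h : L) (a b : weight H).
Hypothesis charF : [pchar F] =i pred0.
Hypothesis simpleL : is_simple L.
Hypothesis cartanH : is_cartan H.

Lemma cartan_sub : is_subalgebra H. Proof. by case: cartanH. Qed.

Local Notation lcs i := (iter i (lie_prod H) H).

Lemma lcs_decr i : (lcs i.+1 <= lcs i)%VS.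
Proof.
elim: i => [|i IHi]; apply: lie_prod_sub => x y Hx Hy; first exact: cartan_sub.
by rewrite mem_lie_prod // (subvP IHi).
Qed.

Lemma lcs_sub i : (lcs i <= H)%VS.
Proof. by elim: i => [|i IHi]; rewrite ?subvv // (subv_trans (lcs_decr i)). Qed.

Lemma cartan_nil h h' : h \in H -> h' \in H -> gvec h 0 h'.
Proof.
move=> Hh Hh'; case: cartanH => _ [n n0] _; exists n.
suff: iter n (ad_shift h 0) h' \in lcs n by rewrite n0 memv0 => /eqP.
by elim: n {n0} => //= n IHn; rewrite ad_shiftE scale0r subr0 mem_lie_prod.
Qed.

(* Engel's argument along the lower central series of H: starting outside H,
   one normalizes ever larger terms of the series modulo H. *)
Lemma gen0_cartan x : (forall h, h \in H -> gvec h 0 x) -> x \in H.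
Proof.
move=> gx; case: (boolP (x \in H)) => // nHx.
pose Q i y := [/\ y \notin H, forall h, h \in H -> gvec h 0 y
  & forall z, z \in lcs i -> [[z, y]] \in H].
have Qlie i h y : h \in H -> [[h, y]] \notin H -> Q i y -> Q i [[h, y]].
  move=> Hh nHhy [_ gy Qy]; split=> // [h' Hh'|z iz].
    by rewrite -[0]addr0; apply: gvec_lie (gy _ Hh'); apply: cartan_nil.
  rewrite lie_der memvD ?(cartan_sub Hh) ?Qy // lie_anti memvN.
  exact: subvP (lcs_decr i) _ (mem_lie_prod Hh iz).
have [n n0] : exists n, lcs n = 0%VS by case: cartanH.
suff [y [nHy _ Qy] ] : exists y, Q 0%N y.
  case/negP: nHy; case: cartanH => _ _; apply=> h Hh.
  by rewrite lie_anti memvN Qy.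
have Qn : exists y, Q n y.
  exists x; split=> // z; rewrite n0 memv0 => /eqP->.
  by rewrite lie0l mem0v.
elim: n Qn {n0} => // n IHn [y0 Qy0]; apply: IHn.
pose QQ (s : seq L) y := Q n.+1 y /\ forall z, z \in s -> [[z, y]] \in H.
suff [y [ [nHy gy _] Qy] ] : exists y, QQ (vbasis (lcs n) : seq L) y.
  exists y; split=> // z /coord_vbasis->; rewrite lie_suml rpred_sum // => i _.
  by rewrite lieZl memvZ // Qy // mem_nth // size_tuple.
have: {subset (vbasis (lcs n) : seq L) <= lcs n} by move=> z /vbasis_mem.
elim: (vbasis (lcs n) : seq L) => [|w s IHs] sw; first by exists y0.
have [|y QQy] := IHs; first by move=> z sz; rewrite sw // inE sz orbT.
have lw : w \in lcs n by rewrite sw ?mem_head.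
have Hw : w \in H by apply: subvP (lcs_sub n) _ lw.
have [m my] : gvec w 0 y by case: QQy => -[_ gy _] _; apply: gy.
have: iter m (ad_shift w 0) y \in H by rewrite my mem0v.
elim: m y QQy {my} => [|m IHm] y QQy; first by case: QQy => -[/negP].
have [Hwy _|nHwy] := boolP ([[w, y]] \in H).
  exists y; case: QQy => Qy sy; split=> // z; rewrite inE => /predU1P[->//|].
  exact: sy.
rewrite iterSr; apply: IHm; rewrite ad_shiftE scale0r subr0.
case: QQy => Qy sy; split=> [|z sz]; first exact: Qlie.
rewrite lie_der memvD ?(cartan_sub Hw (sy _ sz)) //.
case: Qy => _ _; apply; rewrite lie_anti memvN mem_lie_prod //.
by rewrite sw // inE sz orbT.
Qed.

Lemma gen_indep (A : seq (weight H)) (x : weight H -> L) : uniq A ->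
    {in A, forall a, gen a (x a)} -> \sum_(a <- A) x a = 0 ->
  {in A, forall a, x a = 0}.
Proof.
elim: A x => // b A IHA x /= /andP[nAb uA] gx sx0.
have gA a : a \in A -> gen a (x a) by move=> Aa; apply: gx; rewrite inE Aa orbT.
have xA : {in A, forall a, x a = 0}.
  move=> a Aa; have nab : a != b by apply: contraNneq nAb => <-.
  have [h nh] := lfunPn nab.
  have [n bn] : gvec (vsval h) (b h) (x b) by apply: gx; rewrite mem_head.
  set E := ad_shift (vsval h) (b h) in bn.
  suff: lpow E n (x a) = 0.
    rewrite lpowE => xn; apply: (gvec_uniq (gA a Aa h) _ nh).
    by exists n.
  apply: (IHA (fun a => lpow E n (x a))) => // [c Ac h'|].
    have {}Ac := gA c Ac; rewrite lpowE.
    elim: n {bn} => [|n IHn]; first exact: Ac.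
    rewrite /= ad_shiftE; apply: gvecD; last by rewrite -scaleNr; apply: gvecZ.
    by rewrite -[c h']add0r; apply: gvec_lie IHn; apply: cartan_nil; apply: subvsP.
  have := sx0; rewrite big_cons => /(congr1 (lpow E n)).
  by rewrite linearD linear_sum linear0 /= [X in X + _]lpowE bn add0r.
move=> a; rewrite inE => /predU1P[->|/xA//].
by have := sx0; rewrite big_cons big_seq big1 ?addr0.
Qed.

Definition weight_grading (A : seq (weight H)) (G : weight H -> {vspace L}) :=
  [/\ uniq A, forall a, (a \in A) = (G a != 0%VS), (\sum_(a <- A) G a)%VS = fullv
    & forall a x, x \in G a <-> gen a x].

Lemma weight_gradingP : exists A G, weight_grading A G.
Proof.
have [|s [sumV sP] ] := weight_decomposition charF cartan_nil cartan_sub (V := fullv).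
  by move=> *; apply: memvf.
pose G a := (\sum_(p <- s | p.1 == a) p.2)%VS.
pose A := [seq a <- undup [seq p.1 | p <- s] | G a != 0%VS].
exists A, G; have uA : uniq A by rewrite filter_uniq ?undup_uniq.
have AE a : (a \in A) = (G a != 0%VS).
  rewrite mem_filter mem_undup; case: eqVneq => //= G0; apply/mapP.
  have [ [p sp pa]|nos] := EM (exists2 p, p \in s & a = p.1); first by exists p.
  case/eqP: G0; rewrite /G big_seq_cond big_pred0 // => p.
  by apply/andP => -[sp /eqP pa]; case: nos; exists p.
have Ggen a x : x \in G a -> gen a x.
  rewrite /G big_seq_cond; elim/big_rec: _ x => [|p U /andP[sp /eqP pa] IHU] x.
    by rewrite memv0 => /eqP-> h; apply: gvec0.
  case/memv_addP=> y py [z /IHU gz ->] h; apply: gvecD (gz h).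
  by rewrite -pa; apply: sP sp _ py h.
have sumA : (\sum_(a <- A) G a)%VS = fullv.
  apply/eqP; rewrite eqEsubv subvf sumV /=.
  have sub a : (G a <= \sum_(a <- A) G a)%VS.
    have [->|G0] := eqVneq (G a) 0%VS; first exact: sub0v.
    by rewrite (big_rem a) ?AE //= addvSl.
  apply/subvP => x; rewrite big_seq.
  suff: (\sum_(p <- s | p \in s) p.2 <= \sum_(a <- A) G a)%VS by move/subvP; apply.
  elim/big_rec: _ => [|p U sp IHU]; first exact: sub0v.
  rewrite subv_add IHU andbT; apply: subv_trans (sub p.1).
  by rewrite /G (big_rem p) //= eqxx addvSl.
split=> // a x; split=> [|gx]; first exact: Ggen.
apply: (independent_mem uA sumA Ggen _ gen_indep gx) => c y z gy gz h.
by apply: gvecD (gy h) _; rewrite -scaleN1r; apply: gvecZ.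
Qed.

End CartanDecomposition.

(** * The Killing form *)

Section KillingForm.
Variables (F : fieldType) (L : lieAlgType F).
Implicit Types (x y z : L) (U : {vspace L}).

Definition killing x y : F := ltr (ad x \o ad y)%VF.

Lemma adD x y : ad (x + y) = ad x + ad y.
Proof. by apply/lfunP => z; rewrite !lfun_simp /= lieDl. Qed.

Lemma adZ c x : ad (c *: x) = c *: ad x.
Proof. by apply/lfunP => z; rewrite !lfun_simp /= lieZl. Qed.

Lemma ad_lie x y : ad [[x, y]] = (ad x \o ad y)%VF - (ad y \o ad x)%VF.
Proof. by apply/lfunP => z; rewrite add_lfunE opp_lfunE !comp_lfunE !adE (lie_der x y) addrK. Qed.

Lemma killingC x y : killing x y = killing y x.
Proof. exact: ltrC. Qed.

Lemma killingDl x y z : killing (x + y) z = killing x z + killing y z.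
Proof. by rewrite /killing adD comp_lfunDl linearD. Qed.

Lemma killingZl c x z : killing (c *: x) z = c * killing x z.
Proof. by rewrite /killing adZ -comp_lfunZl linearZ. Qed.

Lemma killing_linear x : scalar (killing x).
Proof. by move=> c y z; rewrite !(killingC x) killingDl killingZl. Qed.

HB.instance Definition _ x := GRing.isSemilinear.Build F L F^o _ (killing x)
  (GRing.semilinear_linear (killing_linear x : linear (killing x : L -> F^o))).

Definition killing_form x : 'Hom(L, F^o) := linfun (killing x : L -> F^o).

Lemma killing_form_linear : linear killing_form.
Proof.
move=> c x y; apply/lfunP => z.
by rewrite add_lfunE scale_lfunE !lfunE /= killingDl killingZl.
Qed.
HB.instance Definition _ := GRing.isSemilinear.Build F L 'Hom(L, F^o) _
  killing_form (GRing.semilinear_linear killing_form_linear).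

Lemma killing_form_surj : (forall x, (forall y, killing x y = 0) -> x = 0) ->
  forall phi : 'Hom(L, F^o), exists s, forall y, phi y = killing s y.
Proof.
move=> nondeg phi; pose f := linfun killing_form.
have : phi \in limg f.
  suff -> : limg f = fullv by apply: memvf.
  apply/eqP; rewrite eqEdim subvf limg_dim_eq.
    by rewrite !dimvf /dim /= muln1.
  apply/eqP; rewrite -subv0; apply/subvP => x; rewrite memv_cap memv_ker memv0.
  case/andP=> _; rewrite lfunE => /eqP/lfunP fx; apply/eqP/nondeg => y.
  by have := fx y; rewrite !lfunE.
by case/memv_imgP=> s _ ->; exists s => y; rewrite !lfunE.
Qed.

Definition trace_form (D : 'End(L)) x : F^o := ltr (D \o ad x)%VF.

Lemma trace_form_linear D : linear (trace_form D).
Proof.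
move=> c x y; rewrite /trace_form adD adZ comp_lfunDr -comp_lfunZr.
by rewrite linearD linearZ.
Qed.
HB.instance Definition _ D := GRing.isSemilinear.Build F L F^o _ (trace_form D)
  (GRing.semilinear_linear (trace_form_linear D)).

Lemma killing_lie x y z : killing [[x, y]] z = killing x [[y, z]].
Proof.
rewrite /killing !ad_lie comp_lfunDl comp_lfunDr !linearD /= comp_lfunNl comp_lfunNr.
rewrite !linearN /=; congr (_ - _); first by rewrite comp_lfunA.
by rewrite [LHS]ltrC [RHS]ltrC comp_lfunA.
Qed.

Lemma ltr_lie_proj x y (p : 'End(L)) U :
    (forall z, p z \in U) -> {in U, forall z, p z = z} ->
    {in U, forall z, [[x, z]] \in U} -> {in U, forall z, [[y, z]] \in U} ->
  ltr (ad [[x, y]] \o p)%VF = 0.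
Proof.
move=> pU pid xU yU.
have stab z : {in U, forall w, [[z, w]] \in U} -> (ad z \o p = p \o (ad z \o p))%VF.
  by move=> zU; apply/lfunP => w; rewrite !comp_lfunE adE (pid _ (zU _ (pU w))).
rewrite ad_lie comp_lfunDl comp_lfunNl linearB /=; apply/eqP.
rewrite subr_eq0 -!comp_lfunA (stab y yU) (stab x xU); apply/eqP.
by rewrite [in LHS]comp_lfunA [LHS]ltrC -[in LHS]comp_lfunA.
Qed.

Lemma simple_perfect U : is_simple L -> (forall x y, [[x, y]] \in U) -> U = fullv.
Proof.
case=> -[x [y xy0] ] simpleL xyU; have [|U0|//] := simpleL U; first by [].
by case/eqP: xy0; apply/eqP; rewrite -memv0 -U0 xyU.
Qed.

End KillingForm.

Section GradedAlgebra.
Variables (F : closedFieldType) (L : lieAlgType F) (H : {vspace L}).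
Implicit Types (U V W : {vspace L}) (x y z : L) (a b c : weight H).
Implicit Types (h : subvs_of H).
Hypothesis charF : [pchar F] =i pred0.
Hypothesis simpleL : is_simple L.
Hypothesis cartanH : is_cartan H.
Variables (A : seq (weight H)) (G : weight H -> {vspace L}).
Hypothesis gradA : weight_grading A G.

Lemma wg_uniq : uniq A. Proof. by case: gradA. Qed.
Lemma wg_mem a : (a \in A) = (G a != 0%VS). Proof. by case: gradA. Qed.
Lemma wg_full : (\sum_(a <- A) G a)%VS = fullv. Proof. by case: gradA. Qed.
Lemma wg_gen a x : x \in G a <-> gen a x. Proof. by case: gradA. Qed.

Lemma wg_mem_vec a x : x \in G a -> x != 0 -> a \in A.
Proof.
rewrite wg_mem => Gx; apply: contra_neq => G0.
by move: Gx; rewrite G0 memv0 => /eqP.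
Qed.

Lemma wg_indep (x : weight H -> L) : {in A, forall a, x a \in G a} ->
  \sum_(a <- A) x a = 0 -> {in A, forall a, x a = 0}.
Proof.
move=> Gx; apply: (gen_indep cartanH wg_uniq) => a Aa.
exact/wg_gen/Gx.
Qed.

Lemma wg_lie a b x y : x \in G a -> y \in G b -> [[x, y]] \in G (a + b).
Proof.
move=> /wg_gen gx /wg_gen gy; apply/wg_gen => h; rewrite add_lfunE.
exact: gvec_lie (gx h) (gy h).
Qed.

Lemma wg0 : G 0 = H.
Proof.
apply/vspaceP => x; apply/idP/idP => [/wg_gen gx|Hx].
  apply: (gen0_cartan cartanH) => h Hh.
  by have := gx (Subvs Hh); rewrite lfunE.
by apply/wg_gen => h; rewrite lfunE; apply: (cartan_nil cartanH) => //; apply: subvsP.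
Qed.

Local Notation dimF a := ((\dim (G a))%:R : F).

Lemma wg_ad a h x : x \in G a -> [[vsval h, x]] \in G a.
Proof.
move=> Gx; rewrite -[a]add0r; apply: wg_lie Gx; rewrite wg0; exact: subvsP.
Qed.

Lemma ltr_cartan P h :
  ltr (ad (vsval h) \o gproj wg_full P)%VF = \sum_(a <- A | P a) (a h : F) * dimF a.
Proof.
apply: (ltr_gproj wg_uniq wg_full wg_indep (c := fun a => a h : F)) => a Aa Pa x Gx.
  by rewrite adE wg_ad.
by have /wg_gen/(_ h) := Gx.
Qed.

Lemma killing_cartan1 h :
  killing (vsval h) (vsval h) = \sum_(a <- A) (a h : F) * (a h : F) * dimF a.
Proof.
rewrite /killing -[X in ltr X]comp_lfun1r.
rewrite -(gproj_predT wg_uniq wg_full wg_indep).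
apply: (ltr_gproj wg_uniq wg_full wg_indep (c := fun a => (a h : F) * a h)) => a Aa _ x Gx.
  by rewrite comp_lfunE !adE !wg_ad.
have /wg_gen/(_ h)[n xn] := Gx; exists n; elim: n x {Gx} xn => // n IHn x.
set E := ad_shift _ _ in IHn *; set f := (_ - _) in IHn * => xn.
have fE : f x = E (E x + (a h + a h : F) *: x).
  have -> : E x + (a h + a h : F) *: x = [[vsval h, x]] + a h *: x.
    by rewrite /E ad_shiftE scalerDl addrA addrNK.
  rewrite /E ad_shiftE /f !lfun_simp /= lieDr lieZr scalerDr scalerA opprD.
  by rewrite addrA addrK.
rewrite iterSr; apply: IHn.
by rewrite fE -iterSr iter_lfunP -iterSr iterS xn linear0 scaler0 addr0.
Qed.

Lemma killing_cartan h h' :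
  killing (vsval h) (vsval h') = \sum_(a <- A) (a h : F) * (a h' : F) * dimF a.
Proof.
have two0 : (2%:R : F) != 0 by rewrite (natf_eq0 charF).
apply: (mulfI two0); have := killing_cartan1 (h + h').
rewrite /= killingDl !(killingC _ (_ + _)) !killingDl (killingC _ (vsval h)).
rewrite !killing_cartan1.
set S := \sum_(a <- A) _; set S' := \sum_(a <- A) _.
pose T := \sum_(a <- A) (a h : F) * (a h' : F) * dimF a; rewrite -/T.
set K := killing _ _.
have -> : \sum_(a <- A) (a (h + h') : F) * (a (h + h') : F) * dimF a = S + T + (T + S').
  rewrite /S /T /S' -!big_split; apply: eq_bigr => a _; rewrite linearD /=.
  by rewrite !mulrDl !mulrDr (mulrC (a h')) !mulrDl -!addrA.
by rewrite -!addrA => /addrI; rewrite !addrA => /addIr; rewrite !mulr_natl !mulr2n.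
Qed.

Lemma wg_ind (Q : L -> Prop) :
    Q 0 -> (forall x y, Q x -> Q y -> Q (x + y)) ->
    (forall a x, a \in A -> x \in G a -> Q x) -> forall x, Q x.
Proof.
move=> Q0 QD QG x; have: x \in gpart A G xpredT by rewrite /gpart wg_full memvf.
by apply: gpart_ind x => // a x Aa _; apply: QG.
Qed.

Lemma killing_ortho a b x y : x \in G a -> y \in G b -> a + b != 0 ->
  killing x y = 0.
Proof.
move=> Gx Gy ab0; apply: (ltr_offdiag wg_uniq wg_full wg_indep) => c z Ac Gz.
rewrite comp_lfunE !adE; have := wg_lie Gx (wg_lie Gy Gz).
rewrite addrA; set w := [[x, _]] => Gw.
have [->|w0] := eqVneq w 0; first exact: mem0v.
suff nc : predC1 c (a + b + c).
  exact: (subvP (gpart_sub G (wg_mem_vec Gw w0) nc) _ Gw).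
by rewrite /= -subr_eq0 addrK.
Qed.

Lemma weight_mulrz a (j : int) h : (a *~ j) h = j%:~R * (a h : F).
Proof. by rewrite -scaler_int scale_lfunE. Qed.

Lemma string_lemma a b x y h : x \in G a -> y \in G (- a) ->
    vsval h = [[x, y]] -> b \in A ->
  exists (m : nat) (k : int), m != 0%N /\ m%:R * (b h : F) = k%:~R * (a h : F).
Proof.
move=> Gx Gy hxy Ab.
pose P c := `[< exists j : int, c = b + a *~ j >].
have stab (d : weight H) z : z \in G d -> (exists i : int, d = a *~ i) ->
    {in gpart A G P, forall w, [[z, w]] \in gpart A G P}.
  move=> Gz [i di]; suff: {in gpart A G P, forall w, ad z w \in gpart A G P}.
    by move=> zP w Pw; rewrite -adE zP.
  apply: gpart_stable => c w Ac /asboolP[j cj] Gw; rewrite adE.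
  have := wg_lie Gz Gw; have [->|v0] := eqVneq [[z, w]] 0; first by rewrite !mem0v.
  move=> Gv; have Pv : P (d + c).
    by apply/asboolP; exists (i + j); rewrite cj di addrCA mulrzDr.
  exact: (subvP (gpart_sub G (wg_mem_vec Gv v0) Pv) _ Gv).
have tr0 : \sum_(c <- A | P c) (c h : F) * dimF c = 0.
  rewrite -ltr_cartan hxy.
  apply: (ltr_lie_proj (U := gpart A G P)).
  - exact: gproj_mem.
  - exact: gproj_id wg_uniq _ wg_indep _.
  - by apply: stab Gx _; exists 1.
  - by apply: stab Gy _; exists (-1); rewrite mulrN1z.
have [k kE] : exists k : int, \sum_(c <- A | P c) (c h : F) * dimF c =
    (\sum_(c <- A | P c) \dim (G c))%N%:R * (b h : F) + k%:~R * (a h : F).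
  elim: (A) => [|c s [k IHs] ]; first by exists 0; rewrite !big_nil !mul0r addr0.
  rewrite !big_cons; case: ifP => [/asboolP[j cj]|_]; last by exists k.
  exists (k + j * (\dim (G c))%:Z); rewrite IHs cj add_lfunE weight_mulrz.
  rewrite natrD rmorphD rmorphM /= -pmulrn.
  suff ringE (u v w r t q : F) :
      (u + r * v) * w + (q * u + t * v) = (w + q) * u + (t + r * w) * v.
    exact: ringE.
  by ring.
exists (\sum_(c <- A | P c) \dim (G c))%N, (- k); split.
  rewrite (big_rem b) //= ifT; last by apply/asboolP; exists 0; rewrite mulr0z addr0.
  by rewrite addn_eq0 dimv_eq0 negb_and -wg_mem Ab.
by apply/eqP; rewrite -subr_eq0 mulrNz mulNr opprK -kE tr0.
Qed.
End GradedAlgebra.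

Section CartanCriterion.
Variables (F : closedFieldType) (L : lieAlgType F) (H : {vspace L}).
Implicit Types (U V W : {vspace L}) (x y z : L) (a b c : weight H).
Implicit Types (h : subvs_of H).
Hypothesis charF : [pchar F] =i pred0.
Hypothesis simpleL : is_simple L.
Hypothesis cartanH : is_cartan H.
Variables (A : seq (weight H)) (G : weight H -> {vspace L}).
Hypothesis gradA : weight_grading A G.
Local Notation dimF a := ((\dim (G a))%:R : F).

Let wg0' := wg0 cartanH gradA.
Let fullA := wg_full gradA.
Let uA := wg_uniq gradA.
Let iA := wg_indep cartanH gradA.

Lemma killing_sum_squares a h (s : seq (weight H)) : (a h : F) != 0 -> uniq s ->
    {subset s <= A} ->
    (forall c, c \in A -> exists (m : nat) (k : int),
       m != 0%N /\ m%:R * (c h : F) = k%:~R * (a h : F)) ->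
  exists m k : nat, [/\ m != 0%N, a \in s -> k != 0%N &
    m%:R * (\sum_(c <- s) (c h : F) * (c h : F) * dimF c) = k%:R * ((a h : F) * (a h : F))].
Proof.
move=> ah0 us sA strA; elim: s us sA => [|c s IHs] /=.
  by exists 1%N, 0%N; rewrite big_nil mulr0 mul0r.
case/andP=> nsc us sA; have [|m [k [m0 k0 mk] ] ] := IHs us.
  by move=> d sd; rewrite sA // inE sd orbT.
have Ac : c \in A by rewrite sA ?mem_head.
have [m' [k' [m'0 mk'] ] ] := strA c Ac.
exists (m' * m' * m)%N, (m * (`|k'| * `|k'|) * \dim (G c) + m' * m' * k)%N.
split; first by rewrite !muln_eq0 !negb_or m'0 m0.
  rewrite inE => /predU1P[ac|/k0 {}k0].
    have k'0 : k' != 0.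
      apply: contraNneq ah0 => k'0; have /eqP := mk'.
      by rewrite k'0 mul0r -ac mulf_eq0 (natf_eq0 charF) (negPf m'0).
    rewrite addn_eq0 negb_and !muln_eq0 !negb_or m0 absz_eq0 k'0 dimv_eq0.
    by rewrite -(wg_mem gradA) Ac.
  by rewrite addn_eq0 negb_and !muln_eq0 !negb_or m'0 k0 orbT.
have kk : ((`|k'| * `|k'|)%N%:R : F) = k'%:~R * k'%:~R.
  rewrite natrM; case: (k') => n //.
  by rewrite NegzE abszN absz_nat rmorphN /= mulrNN.
rewrite big_cons mulrDr natrD mulrDl; congr (_ + _).
  rewrite [in RHS]natrM [in RHS]natrM kk !natrM.
  have -> : m'%:R * m'%:R * m%:R * ((c h : F) * (c h : F) * dimF c)
    = m%:R * dimF c * ((m'%:R * (c h : F)) * (m'%:R * (c h : F))) by ring.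
  by rewrite mk'; ring.
rewrite [in RHS]natrM -[RHS]mulrA -mk !natrM; ring.
Qed.

Lemma killing0_weight0 a b x y h : (forall x y : L, killing x y = 0) ->
  x \in G a -> y \in G (- a) -> vsval h = [[x, y]] -> b \in A -> b h = 0.
Proof.
move=> K0 Gx Gy hxy Ab.
have [x0|x0] := eqVneq x 0.
  suff -> : h = 0 by exact: linear0.
  by apply: val_inj; rewrite /= hxy x0 lie0l.
have Aa := wg_mem_vec gradA Gx x0.
have strA c (Ac : c \in A) := string_lemma cartanH gradA Gx Gy hxy Ac.
have [ah0|ah0] := eqVneq (a h : F) 0.
  have [m [k [m0 /eqP] ] ] := strA b Ab.
  by rewrite ah0 mulr0 mulf_eq0 (natf_eq0 charF) (negPf m0) => /eqP.
have [|m [k [m0 k0] ] ] := killing_sum_squares ah0 uA _ strA; first by [].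
rewrite -(killing_cartan1 cartanH gradA) K0 mulr0 => /esym/eqP.
by rewrite !mulf_eq0 (negPf ah0) !orbF (natf_eq0 charF) (negPf (k0 Aa)).
Qed.

Lemma killing_neq0 : ~ (forall x y : L, killing x y = 0).
Proof.
move=> K0.
have A0 b : b \in A -> b = 0.
  move=> Ab; pose psi : 'Hom(L, F^o) := (b \o linfun (vsproj H))%VF.
  pose phi : 'Hom(L, F^o) := (psi \o gproj fullA (pred1 0))%VF.
  have psiE x : psi x = b (vsproj H x) by rewrite !lfun_simp.
  have phiE x : phi x = psi (gproj fullA (pred1 0) x) by rewrite comp_lfunE.
  have phi_lie x y : [[x, y]] \in lker phi.
    move: x; apply: (wg_ind gradA) => [|x1 x2 x1E x2E|a x Aa Gx].
    - by rewrite lie0l mem0v.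
    - by rewrite lieDl memvD.
    move: y; apply: (wg_ind gradA) => [|y1 y2 y1E y2E|c y Ac Gy].
    - by rewrite lie0r mem0v.
    - by rewrite lieDr memvD.
    have Gxy := wg_lie gradA Gx Gy.
    have [-> | xy0] := eqVneq [[x, y]] 0; first exact: mem0v.
    rewrite memv_ker phiE (gproj_homog uA fullA iA _ (wg_mem_vec gradA Gxy xy0) Gxy) /=.
    case: (eqVneq (a + c) 0) => [ac0|_]; last by rewrite linear0 eqxx.
    rewrite psiE; apply/eqP; apply: (killing0_weight0 K0 Gx _ _ Ab) => [|].
      by rewrite -(addr0_eq ac0) in Gy *; exact: Gy.
    by rewrite vsprojK // -wg0' -ac0.
  have kerT := simple_perfect simpleL phi_lie.
  apply/lfunP => h; rewrite lfunE.
  have: vsval h \in lker phi by rewrite kerT memvf.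
  rewrite memv_ker phiE => /eqP.
  have Hh : vsval h \in G 0 by rewrite wg0' subvsP.
  have [h0 _|h0] := eqVneq (vsval h) 0.
    have -> : h = 0 by apply: val_inj.
    exact: linear0.
  rewrite (gproj_homog uA fullA iA _ (wg_mem_vec gradA Hh h0) Hh) /= eqxx.
  by rewrite psiE vsvalK.
have HT : H = fullv.
  rewrite -wg0'; apply/eqP; rewrite eqEsubv subvf -fullA big_seq /=.
  elim/big_rec: _ => [|b U Ab IHU]; first exact: sub0v.
  by rewrite subv_add IHU andbT (A0 b Ab).
have perfT : lie_prod fullv fullv = fullv :> {vspace L}.
  by apply: (simple_perfect simpleL) => x y; apply: mem_lie_prod; apply: memvf.
have [_ [n n0] _] := cartanH; rewrite HT in n0.
have: iter n (lie_prod fullv) fullv = fullv :> {vspace L} by elim: n {n0} => //= n ->.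
rewrite n0 => T0; case: simpleL => -[x [y xy0] ] _.
by move: xy0; rewrite -memv0 T0 memvf.
Qed.

Lemma killing_nondeg x : (forall y, killing x y = 0) -> x = 0.
Proof.
move=> Kx; pose I := lker (linfun (@killing_form _ L)).
have memI z : z \in I <-> forall y, killing z y = 0.
  rewrite memv_ker lfunE; split=> [/eqP/lfunP Kz y|Kz].
    by have := Kz y; rewrite !lfunE.
  by apply/eqP/lfunP => y; rewrite !lfunE /= Kz.
have [I0|IT] : I = 0%VS \/ I = fullv.
- case: simpleL => _; apply => y z /memI Kz; apply/memI => w.
  by rewrite lie_anti -scaleN1r killingZl killing_lie Kz mulr0.
- by apply/eqP; rewrite -memv0 -I0; apply/memI.
- by case: killing_neq0 => z w; have /memI-> : z \in I by rewrite IT memvf.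
Qed.

End CartanCriterion.

Section Diagonal.
Variables (F : closedFieldType) (L : lieAlgType F) (H : {vspace L}).
Implicit Types (U V W : {vspace L}) (x y z : L) (a b c : weight H).
Implicit Types (h : subvs_of H).
Hypothesis charF : [pchar F] =i pred0.
Hypothesis simpleL : is_simple L.
Hypothesis cartanH : is_cartan H.

Section Graded.
Variables (A : seq (weight H)) (G : weight H -> {vspace L}).
Hypothesis gradA : weight_grading A G.
Let wg0' := wg0 cartanH gradA.
Let fullA := wg_full gradA.
Let uA := wg_uniq gradA.
Let iA := wg_indep cartanH gradA.

Lemma weights_sep h : (forall b, b \in A -> b h = 0) -> h = 0.
Proof.
move=> bh0; apply: val_inj; apply: (killing_nondeg charF simpleL cartanH gradA).
apply: (wg_ind gradA) => [|x y xE yE|a y Aa Gy].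
- exact: linear0.
- by rewrite linearD /= xE yE addr0.
have Hh : vsval h \in G 0 by rewrite wg0' subvsP.
have [a0|a0] := eqVneq a 0; last first.
  by apply: (killing_ortho cartanH gradA Hh Gy); rewrite add0r.
rewrite a0 wg0' in Gy; rewrite -[y]/(vsval (Subvs Gy)).
rewrite (killing_cartan charF cartanH gradA) big_seq big1 // => b Ab.
by rewrite bh0 // !mul0r.
Qed.

Lemma cartan_abelian x y : x \in H -> y \in H -> [[x, y]] = 0.
Proof.
move=> Hx Hy; have Hxy := cartan_sub cartanH Hx Hy.
suff: Subvs Hxy = 0 by move/(congr1 vsval).
apply: weights_sep => b Ab; have: ltr (ad [[x, y]] \o gproj fullA (pred1 b))%VF = 0.
  have stab h : {in gpart A G (pred1 b), forall w, [[vsval h, w]] \in gpart A G (pred1 b)}.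
    by move=> w; rewrite gpart1 //; apply: (wg_ad cartanH gradA).
  apply: (ltr_lie_proj (U := gpart A G (pred1 b))).
  - exact: gproj_mem.
  - exact: gproj_id uA _ iA _.
  - exact: (stab (Subvs Hx)).
  - exact: (stab (Subvs Hy)).
have := ltr_cartan cartanH gradA (pred1 b) (Subvs Hxy) => /= -> .
rewrite (big_pred1_uniq _ _ uA Ab) => /eqP.
rewrite mulf_eq0 (natf_eq0 charF) dimv_eq0 -[X in _ || X]negbK -(wg_mem gradA) Ab.
by rewrite orbF => /eqP.
Qed.

(* The semisimple part D of ad h is a derivation, hence inner; as it kills H, it is
   ad s for some s in H, and the weights agree on s and h. *)
Lemma cartan_diag a h x : x \in G a -> [[vsval h, x]] = (a h : F) *: x.
Proof.
pose D : 'End(L) := \sum_(b <- A) (b h : F) *: gproj1 fullA b.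
have DE b y : y \in G b -> D y = (b h : F) *: y.
  move=> Gy; have [->|y0] := eqVneq y 0; first by rewrite linear0 scaler0.
  have Ab := wg_mem_vec gradA Gy y0.
  rewrite sum_lfunE (eq_big_seq (fun c => if c == b then (b h : F) *: y else 0)).
    exact: sum_delta_uniq.
  move=> c Ac; rewrite scale_lfunE (gproj1_delta uA fullA iA Ac Ab Gy).
  by case: eqVneq => [->//|_]; rewrite scaler0.
have Dlie y z : D [[y, z]] = [[D y, z]] + [[y, D z]].
  move: y; apply: (wg_ind gradA) => [|y1 y2 y1E y2E|b y _ Gy].
  - by rewrite !(lie0l, linear0) addr0.
  - by rewrite lieDl !linearD /= y1E y2E !lieDl addrACA.
  move: z; apply: (wg_ind gradA) => [|z1 z2 z1E z2E|c z _ Gz].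
  - by rewrite !(lie0r, linear0) addr0.
  - by rewrite !linearD /= z1E z2E addrACA.
  by rewrite (DE _ _ (wg_lie gradA Gy Gz)) (DE _ _ Gy) (DE _ _ Gz) lieZl lieZr -scalerDl add_lfunE.
have [s sE] : exists s, forall y, ltr (D \o ad y)%VF = killing s y.
  have [s sE] := killing_form_surj (killing_nondeg charF simpleL cartanH gradA)
    (linfun (trace_form D)).
  by exists s => y; rewrite -sE lfunE.
have Ds y : D y = [[s, y]].
  apply/eqP; rewrite -subr_eq0; apply/eqP.
  apply: (killing_nondeg charF simpleL cartanH gradA) => z.
  rewrite -scaleN1r killingDl killingZl mulN1r killing_lie -sE ad_lie.
  have adDy : ad (D y) = (D \o ad y)%VF - (ad y \o D)%VF.
    by apply/lfunP => w; rewrite add_lfunE opp_lfunE !comp_lfunE !adE Dlie addrK.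
  rewrite /killing adDy comp_lfunDl comp_lfunDr comp_lfunNl comp_lfunNr !linearB /=.
  rewrite -!comp_lfunA (ltrC (ad y)) -!comp_lfunA subrr.
  by [].
have Hs : s \in H.
  case: cartanH => _ _; apply=> h' Hh'; rewrite -Ds.
  rewrite (DE 0) ?wg0' // memvZ //.
suff hs : h = Subvs Hs by move=> Gx; rewrite {1}hs /= -Ds (DE a).
apply/eqP; rewrite -subr_eq0; apply/eqP; apply: weights_sep => b Ab.
rewrite linearB /=; apply/eqP; rewrite subr_eq0; apply/eqP.
have Gy : vpick (G b) \in G b by apply: memv_pick.
have y0 : vpick (G b) != 0 by rewrite vpick0 -(wg_mem gradA).
have /(wg_gen gradA)/(_ (Subvs Hs)) /= sy := Gy.
apply/eqP; apply: contraNT y0 => bhs; apply/eqP.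
apply: (gvec_uniq sy (d := b h)); last by rewrite eq_sym.
exists 1%N.
by rewrite /= ad_shiftE -Ds (DE b) // subrr.
Qed.
End Graded.

Lemma root_grading : exists A, weight_grading A (@root_space F L H).
Proof.
have [A [G gradA] ] := weight_gradingP charF cartanH.
have GE a : G a = root_space a.
  apply/vspaceP => x; apply/idP/root_spaceP => [Gx h|diag].
    exact: cartan_diag gradA _ _ _ Gx.
  apply/(wg_gen gradA) => h; exists 1%N.
  by rewrite /= ad_shiftE diag subrr.
exists A; case: (gradA) => uA memA sumA genA; split=> // [a||a x].
- by rewrite memA GE.
- by rewrite -sumA; apply: eq_bigr => a _.
- by rewrite -GE.
Qed.

End Diagonal.

(** * Representations of sl2 and root strings *)

Section Sl2.
Variables (F : fieldType) (L : lieAlgType F).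
Implicit Types (e f h x v w : L) (c : F).
Hypothesis charF : [pchar F] =i pred0.

Definition sl2_triple e f h :=
  [/\ [[e, f]] = h, [[h, e]] = 2%:R *: e & [[h, f]] = - 2%:R *: f].

Lemma sl2_triple_sym e f h : sl2_triple e f h -> sl2_triple f e (- h).
Proof.
by case=> ef he hf; split; rewrite ?lieNl ?he ?hf -?scaleNr ?opprK // -ef lie_anti.
Qed.

Local Notation "e ^^ n" := (iter n (lie e)) (at level 20, n at level 2).

Lemma iter_lieE e n v : e ^^ n v = iter n (ad e) v.
Proof. by elim: n => //= n ->; rewrite adE. Qed.

Lemma iter_lie0 e n : e ^^ n 0 = 0.
Proof. by rewrite iter_lieE iter_lfun0. Qed.

Variables e f h : L.
Hypothesis efh : sl2_triple e f h.

Lemma sl2_weight_e c v : [[h, v]] = c *: v -> [[h, [[e, v]]]] = (c + 2%:R) *: [[e, v]].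
Proof.
by case: efh => _ he _ hv; rewrite lie_der he hv lieZl lieZr -scalerDl addrC.
Qed.

Lemma sl2_weight_f c v : [[h, v]] = c *: v -> [[h, [[f, v]]]] = (c - 2%:R) *: [[f, v]].
Proof.
by case: efh => _ _ hf hv; rewrite lie_der hf hv lieZl lieZr -scalerDl addrC.
Qed.

Lemma sl2_weight_iter c v n : [[h, v]] = c *: v ->
  [[h, e ^^ n v]] = (c + n%:R *+ 2) *: e ^^ n v.
Proof.
move=> hv; elim: n => [|n IHn] /=; first by rewrite mul0rn addr0.
rewrite (sl2_weight_e IHn); congr (_ *: _); ring.
Qed.

Lemma sl2_comm c v n : [[h, v]] = c *: v ->
  [[f, e ^^ n.+1 v]] = e ^^ n.+1 [[f, v]] - (n.+1%:R * (c + n%:R)) *: e ^^ n v.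
Proof.
move=> hv; have fe w : [[f, [[e, w]]]] = [[e, [[f, w]]]] - [[h, w]].
  by case: efh => ef _ _; rewrite lie_der (lie_anti f e) ef lieNl addrC.
elim: n => [|n IHn]; first by rewrite /= fe hv addr0 mul1r.
rewrite iterS fe IHn (sl2_weight_iter n.+1 hv) lieDr lieNr lieZr -addrA -opprD -scalerDl.
congr (_ - _ *: _).
ring.
Qed.

Lemma sl2_primitive c v N : v != 0 -> [[h, v]] = c *: v -> [[f, v]] = 0 ->
  e ^^ N v = 0 -> exists n : nat, c = - n%:R.
Proof.
move=> v0 hv fv; elim: N => [/eqP|N IHN]; first by rewrite (negPf v0).
have [/IHN//|eN0 eN1] := eqVneq (e ^^ N v) 0.
have := sl2_comm N hv; rewrite eN1 fv iter_lie0 lie0r sub0r => /esym/eqP.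
rewrite oppr_eq0 scaler_eq0 (negPf eN0) orbF mulf_eq0.
have /pcharf0P-> := charF; rewrite /= addr_eq0 => /eqP cN.
by exists N.
Qed.

(* Induction on the f-nilpotency order of v: f v satisfies the same hypotheses, with
   k + 2 and m + 1. *)
Lemma sl2_string_inj r m k v : iter r (lie f) v = 0 -> [[h, v]] = - k%:R *: v ->
  e ^^ m v = 0 -> (m <= k)%N -> v = 0.
Proof.
elim: r m k v => [//|r IHr] m k v fv hv.
elim: m => [//|m IHm] em lt_mk.
have comm := sl2_comm m hv; rewrite em lie0r in comm.
have fv0 : [[f, v]] = 0.
  apply: (IHr m.+2 k.+2); [by rewrite -iterSr | | |exact: ltnW].
    by rewrite (sl2_weight_f hv); congr (_ *: _); ring.
  rewrite iterS; move/esym/eqP: comm; rewrite subr_eq0 => /eqP->.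
  by rewrite lieZr -iterS em scaler0.
move/esym/eqP: comm; rewrite fv0 iter_lie0 sub0r oppr_eq0 scaler_eq0 mulf_eq0.
have /pcharf0P charF0 := charF; rewrite charF0 /= => /orP[|/eqP em0]; last first.
  by apply: IHm => //; apply: ltnW.
rewrite addrC subr_eq0 => /eqP mk.
have: ((k - m)%N%:R : F) == 0 by rewrite natrB ?mk ?subrr // ltnW.
by rewrite charF0 subn_eq0 leqNgt lt_mk.
Qed.

Lemma sl2_no_lowering k v n : v != 0 -> [[h, v]] = k.+1%:R *: v ->
  [[e, [[f, v]]]] = 0 -> e ^^ n v != 0.
Proof.
move=> v0 hv efv; elim: n => // n IHn.
apply: contraNneq IHn => en1; have := sl2_comm n hv.
rewrite en1 lie0r iterSr efv iter_lie0 sub0r => /esym/eqP.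
rewrite oppr_eq0 scaler_eq0 mulf_eq0 -natrD.
by have /pcharf0P charF0 := charF; rewrite !charF0.
Qed.

End Sl2.

Section RootStrings.
Variables (F : closedFieldType) (L : lieAlgType F) (H : {vspace L}).
Implicit Types (U V W : {vspace L}) (x y z : L) (a b c : weight H).
Implicit Types (h : subvs_of H).
Hypothesis charF : [pchar F] =i pred0.
Hypothesis simpleL : is_simple L.
Hypothesis cartanH : is_cartan H.
Variable A : seq (weight H).
Hypothesis gradA : weight_grading A (@root_space F L H).
Local Notation rs := (@root_space F L H).
Local Notation "e ^^ n" := (iter n (lie e)) (at level 20, n at level 2).

Lemma rs0 : rs 0 = H. Proof. exact: wg0 gradA. Qed.

Lemma rs_lie a b x y : x \in rs a -> y \in rs b -> [[x, y]] \in rs (a + b).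
Proof. by move=> xa yb; exact: (wg_lie gradA xa yb). Qed.

Lemma rs_lie0 a b x y : x \in rs a -> y \in rs b -> a + b \notin A -> [[x, y]] = 0.
Proof.
move=> ax yb nA; apply/eqP; apply: contraNT nA => /(wg_mem_vec gradA).
by apply; apply: rs_lie.
Qed.

Lemma rsE a h x : x \in rs a -> [[vsval h, x]] = (a h : F) *: x.
Proof. by move/root_spaceP. Qed.

Lemma rsEH a x z (Hz : z \in H) : x \in rs a -> [[z, x]] = (a (Subvs Hz) : F) *: x.
Proof. by move/root_spaceP/(_ (Subvs Hz)). Qed.

Lemma root_nz a : a \in A -> exists2 v, v \in rs a & v != 0.
Proof.
by rewrite (wg_mem gradA) => a0; exists (vpick (rs a)); rewrite ?memv_pick ?vpick0.
Qed.

Lemma is_rootE a : is_root a = (a != 0) && (a \in A).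
Proof. by rewrite /is_root -(wg_mem gradA). Qed.

Lemma weight_mulrn a n h : (a *+ n) h = n%:R * (a h : F).
Proof. by rewrite -scaler_nat scale_lfunE. Qed.

Lemma rs_nilpotent a b x y : a != 0 -> x \in rs a -> y \in rs b ->
  exists n, x ^^ n y = 0.
Proof.
move=> a0 xa yb; have memn n : x ^^ n y \in rs (b + a *+ n).
  elim: n => [|n IHn]; first by rewrite addr0.
  by rewrite mulrS addrCA; exact: (rs_lie xa IHn).
have [ [n nA]|allA] := EM (exists n, b + a *+ n \notin A).
  exists n; apply/eqP; apply: contraNT nA => xn0.
  exact: (wg_mem_vec gradA (memn n) xn0).
pose s := [seq b + a *+ n | n <- iota 0 (size A).+1].
have us : uniq s.
  rewrite map_inj_uniq ?iota_uniq // => m n /addrI amn.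
  have [h ah] := lfunPn a0; rewrite lfunE /= in ah.
  have := congr1 (fun g : weight H => (g h : F)) amn.
  by rewrite /= !weight_mulrn => /(mulIf ah)/(natf_inj charF).
have sA : {subset s <= A}.
  move=> _ /mapP[n _ ->]; apply: contra_notT allA => nA; by exists n.
by have := uniq_leq_size us sA; rewrite size_map size_iota ltnn.
Qed.

Lemma root_sl2 a : is_root a -> exists e f h,
  [/\ e \in rs a, f \in rs (- a), sl2_triple e f (vsval h) & (a h : F) = 2%:R].
Proof.
rewrite is_rootE => /andP[a0 Aa]; have [e ea e0] := root_nz Aa.
have [f fa K0] : exists2 f, f \in rs (- a) & killing e f != 0.
  have [ [f fa Kf]|noK] := EM (exists2 f, f \in rs (- a) & killing e f != 0).
    by exists f.
  case/eqP: e0; apply: (killing_nondeg charF simpleL cartanH gradA).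
  apply: (wg_ind gradA) => [|y z yE zE|b y Ab yb]; first exact: linear0.
    by rewrite linearD /= yE zE addr0.
  have [ab0|] := eqVneq (a + b) 0; last exact: (killing_ortho cartanH gradA ea yb).
  have [->|Kn] := eqVneq (killing e y) 0; first by [].
  by case: noK; exists y; [rewrite (addr0_eq ab0) | exact: Kn].
have Hh0 : [[e, f]] \in H by have := rs_lie ea fa; rewrite subrr rs0.
have [h' ah'] := lfunPn a0; rewrite lfunE /= in ah'.
have h0 : [[e, f]] != 0.
  apply: contraNneq K0 => ef0; have := killing_lie (vsval h') e f.
  rewrite ef0 (rsE h' ea) killingZl linear0 => /eqP.
  by rewrite mulf_eq0 (negPf ah').
pose h := Subvs Hh0.
have ah : (a h : F) != 0.
  apply: contraNneq h0 => ah0.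
  suff : h = 0 by move/(congr1 vsval) => /= ->.
  apply: (weights_sep charF simpleL cartanH gradA) => b Ab.
  have [m [k [m0 /eqP] ] ] := string_lemma cartanH gradA ea fa (h := h) (erefl _) Ab.
  by rewrite ah0 mulr0 mulf_eq0 (natf_eq0 charF) (negPf m0) => /eqP.
pose t := 2%:R / (a h : F).
have ath : (a (t *: h) : F) = 2%:R by rewrite linearZ /= /GRing.scale /= divfK.
exists e, (t *: f), (t *: h); split; [exact: ea | exact: memvZ | | exact: ath].
split; first by rewrite lieZr.
- by rewrite (rsE _ ea) ath.
- by rewrite (rsE _ (memvZ t fa)) opp_lfunE ath.
Qed.

Lemma root_opp a : is_root a -> is_root (- a).
Proof.
move=> ra; have [e [f [h [ea fa [ef he _] ah] ] ] ] := root_sl2 ra.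
move: ra; rewrite !is_rootE oppr_eq0 => /andP[a0 Aa]; rewrite a0 /=.
apply: (wg_mem_vec gradA fa); apply: contraTneq Aa => f0.
rewrite f0 lie0r in ef.
have h0 : h = 0 by apply: val_inj.
by move/eqP: ah; rewrite h0 linear0 eq_sym (natf_eq0 charF).
Qed.

Lemma root_integral a b h e f : is_root a -> e \in rs a -> f \in rs (- a) ->
  sl2_triple e f (vsval h) -> b \in A -> exists k : int, (b h : F) = k%:~R.
Proof.
rewrite is_rootE => /andP[a0 Aa] ea fa efh Ab; have [v vb v0] := root_nz Ab.
have [n en] := rs_nilpotent a0 ea vb.
have [m [em0 em1] ] : exists m, e ^^ m v != 0 /\ e ^^ m.+1 v = 0.
  elim: n en => [/eqP|n IHn en]; first by rewrite (negPf v0).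
  by have [/IHn//|nz] := eqVneq (e ^^ n v) 0; exists n.
have wv := rsE h vb.
have wm := sl2_weight_iter efh m wv.
have [n' fn] : exists n', f ^^ n' (e ^^ m v) = 0.
  have [k km] : exists k, e ^^ m v \in rs (b + a *+ k).
    exists m; elim: (m) => [|k IHk]; first by rewrite addr0.
    by rewrite mulrS addrCA; exact: (rs_lie ea IHk).
  by apply: rs_nilpotent fa km; rewrite oppr_eq0.
have wm' : [[- vsval h, e ^^ m v]] = - ((b h : F) + m%:R *+ 2) *: e ^^ m v.
  by rewrite lieNl wm scaleNr.
have [k /eqP] := sl2_primitive charF (sl2_triple_sym efh) em0 wm' em1 fn.
rewrite eqr_opp -subr_eq0 -addrA addr_eq0 => /eqP->.
exists (k%:Z - m%:Z *+ 2); rewrite rmorphB rmorphMn /= -!pmulrn opprB.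
by [].
Qed.

Lemma root_reflect_inj a b h e f k v : is_root a -> e \in rs a -> f \in rs (- a) ->
  sl2_triple e f (vsval h) -> (b h : F) = - k%:R -> v \in rs b -> e ^^ k v = 0 -> v = 0.
Proof.
rewrite is_rootE => /andP[a0 _] ea fa efh bk vb ek.
have [r fr] : exists n, f ^^ n v = 0.
  by apply: rs_nilpotent fa vb; rewrite oppr_eq0.
apply: (sl2_string_inj charF efh fr _ ek (leqnn k)).
by rewrite (rsE h vb) bk.
Qed.

Lemma root_lie_neq0 a b : is_root a -> is_root b -> is_root (a + b) ->
  exists x y, [/\ x \in rs a, y \in rs b & [[x, y]] != 0].
Proof.
move=> ra rb rab; have [//|nxy] := EM (exists x y,
  [/\ x \in rs a, y \in rs b & [[x, y]] != 0]).
have {}nxy x y : x \in rs a -> y \in rs b -> [[x, y]] = 0.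
  move=> xa yb; have [//|xy0] := eqVneq [[x, y]] 0.
  by case: nxy; exists x, y.
have [e [f [h [ea fa efh ah] ] ] ] := root_sl2 ra.
have := rb; rewrite is_rootE => /andP[_ /root_nz[v vb v0] ].
have := rab; rewrite is_rootE => /andP[_ /root_nz[w wab w0] ].
have := ra; rewrite is_rootE => /andP[a0 _].
have [n fn] : exists n, f ^^ n v = 0.
  by apply: rs_nilpotent fa vb; rewrite oppr_eq0.
have [k bk] : exists k : nat, (b h : F) = k%:R.
  have hv : [[- vsval h, v]] = - (b h : F) *: v by rewrite lieNl (rsE h vb) scaleNr.
  have [k /eqP] := sl2_primitive charF (sl2_triple_sym efh) v0 hv (nxy _ _ ea vb) fn.
  by rewrite eqr_opp => /eqP; exists k.
have fw : [[f, w]] \in rs b.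
  by have := rs_lie fa wab; rewrite addKr.
have hw : [[vsval h, w]] = k.+2%:R *: w.
  by rewrite (rsE h wab) add_lfunE ah bk -natrD.
have [m em] := rs_nilpotent a0 ea wab.
have := sl2_no_lowering charF efh m w0 hw (nxy _ _ ea fw).
by rewrite em eqxx.
Qed.

End RootStrings.

(** * Closed partitions *)

Section ClosedPartitions.
Variables (F : closedFieldType) (L : lieAlgType F) (H : {vspace L}).
Implicit Types (U V W : {vspace L}) (x y z : L) (a b c : weight H).
Implicit Types (h : subvs_of H) (S : {fset (weight H)}).
Hypothesis charF : [pchar F] =i pred0.
Hypothesis simpleL : is_simple L.
Hypothesis cartanH : is_cartan H.
Variable A : seq (weight H).
Hypothesis gradA : weight_grading A (@root_space F L H).
Local Notation rs := (@root_space F L H).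
Local Notation "e ^^ n" := (iter n (lie e)) (at level 20, n at level 2).
Let fullA := wg_full gradA.
Let uA := wg_uniq gradA.
Let iA := wg_indep cartanH gradA.
Local Notation dimF a := ((\dim (rs a))%:R : F).

Lemma is_root_mem a : is_root a -> a \in A.
Proof. by rewrite (is_rootE gradA) => /andP[]. Qed.

Lemma is_root_intro a : a != 0 -> a \in A -> is_root a.
Proof. by rewrite (is_rootE gradA) => -> ->. Qed.

Definition closed_split S1 S2 : Prop :=
  [/\ forall a, is_root a = (a \in S1) || (a \in S2),
      forall a, a \in S1 -> a \in S2 -> False,
      forall a b, a \in S1 -> b \in S1 -> is_root (a + b) -> a + b \in S1 &
      forall a b, a \in S2 -> b \in S2 -> is_root (a + b) -> a + b \in S2].

Lemma closed_split_sym S1 S2 : closed_split S1 S2 -> closed_split S2 S1.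
Proof.
by case=> rS dS c1 c2; split=> // [a|a a2 a1]; [rewrite orbC | apply: dS a1 a2].
Qed.

Definition coroot_span S : {vspace L} :=
  (\sum_(a <- S | - a \in S) lie_prod (rs a) (rs (- a)))%VS.

Lemma coroot_span_sub S W :
    (forall a x y, a \in S -> - a \in S -> x \in rs a -> y \in rs (- a) ->
       [[x, y]] \in W) ->
  (coroot_span S <= W)%VS.
Proof.
move=> SW; rewrite /coroot_span big_seq_cond.
elim/big_rec: _ => [|a U /andP[Sa Sna] IHU]; first exact: sub0v.
rewrite subv_add IHU andbT; apply: lie_prod_sub => x y xa ya.
exact: SW xa ya.
Qed.

Lemma mem_coroot_span S a x y : a \in S -> - a \in S -> x \in rs a ->
  y \in rs (- a) -> [[x, y]] \in coroot_span S.
Proof.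
move=> Sa Sna xa ya; rewrite /coroot_span (big_rem a) //= Sna.
exact: (subvP (addvSl _ _)) (mem_lie_prod xa ya).
Qed.

Lemma coroot_span_cartan S : (coroot_span S <= H)%VS.
Proof.
apply: coroot_span_sub => a x y _ _ xa ya.
by have := rs_lie gradA xa ya; rewrite subrr (rs0 cartanH gradA).
Qed.

Section Split.
Variables S1 S2 : {fset (weight H)}.
Hypothesis S12 : closed_split S1 S2.

Lemma split_root1 a : a \in S1 -> is_root a.
Proof. by case: S12 => -> _ _ _ ->. Qed.

Lemma split_root2 a : a \in S2 -> is_root a.
Proof. by case: S12 => -> _ _ _ ->; rewrite orbT. Qed.

Lemma split_lie0 a b : a \in S1 -> - a \in S1 -> b \in S2 -> - b \in S2 ->
  a + b \notin A.
Proof.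
case: S12 => rS dS c1 c2 a1 na1 b2 nb2; apply/negP => Aab.
have [ab0|ab0] := eqVneq (a + b) 0.
  by apply: (dS b) => //; rewrite -(addr0_eq ab0).
have rab := is_root_intro ab0 Aab.
have := rab; rewrite rS => /orP[ab1|ab2].
  apply: (dS b) => //; have := c1 _ _ na1 ab1; rewrite addKr; apply.
  exact: split_root2.
apply: (dS a) => //; have := c2 _ _ ab2 nb2; rewrite addrK; apply.
exact: split_root1.
Qed.

Lemma coroot_orth b z (Hz : z \in H) : z \in coroot_span S1 ->
  b \in S2 -> - b \in S2 -> b (Subvs Hz) = 0.
Proof.
move=> z1 b2 nb2.
have [v vb v0] := root_nz gradA (is_root_mem (split_root2 b2)).
have zv : [[z, v]] = 0.
  suff: (coroot_span S1 <= lker (ad v))%VS.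
    by move/subvP/(_ _ z1); rewrite memv_ker adE lie_anti oppr_eq0 => /eqP.
  apply: coroot_span_sub => a x y a1 na1 xa ya.
  rewrite memv_ker adE lie_anti oppr_eq0.
  have nna1 : - - a \in S1 by rewrite opprK.
  have xv := rs_lie0 gradA xa vb (split_lie0 a1 na1 b2 nb2).
  have yv := rs_lie0 gradA ya vb (split_lie0 na1 nna1 b2 nb2).
  have := lie_der x y v; rewrite yv lie0r xv lie0r addr0 => <-.
  by rewrite eqxx.
have := rsEH Hz vb; rewrite zv => /esym/eqP; rewrite scaler_eq0 (negPf v0) orbF.
by move/eqP.
Qed.

End Split.

Lemma trace_coroot_span S (P : pred (weight H)) z (Hz : z \in H) :
    (forall a c, a \in S -> - a \in S -> c \in A -> P c -> a + c \in A -> P (a + c)) ->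
    z \in coroot_span S ->
  \sum_(c <- A | P c) (c (Subvs Hz) : F) * dimF c = 0.
Proof.
move=> SP zS; rewrite -(ltr_cartan cartanH gradA) /=.
pose phi := linfun (trace_form (gproj fullA P)).
have phiE x : phi x = ltr (ad x \o gproj fullA P)%VF by rewrite lfunE /= /trace_form ltrC.
have: z \in lker phi.
  apply: subvP zS; apply: coroot_span_sub => a x y Sa Sna xa ya.
  rewrite memv_ker phiE.
  have stab b w : b \in S -> - b \in S -> w \in rs b ->
      {in gpart A rs P, forall v, [[w, v]] \in gpart A rs P}.
    move=> Sb Snb wb v vP; rewrite -adE.
    apply: (gpart_stable _ vP) => c u Ac Pc uc; rewrite adE.
    have buc := rs_lie gradA wb uc.
    have [->|wu0] := eqVneq [[w, u]] 0; first exact: mem0v.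
    have Abc := wg_mem_vec gradA buc wu0.
    have Pbc : P (b + c) by apply: SP.
    exact: (subvP (gpart_sub rs Abc Pbc) _ buc).
  apply/eqP; apply: (ltr_lie_proj (U := gpart A rs P)).
  - exact: gproj_mem.
  - exact: gproj_id uA _ iA _.
  - exact: stab xa.
  - by apply: stab ya; rewrite ?opprK.
by rewrite memv_ker phiE => /eqP.
Qed.

Lemma coroot_span_cap S1 S2 : closed_split S1 S2 ->
  (coroot_span S1 :&: coroot_span S2 = 0)%VS.
Proof.
move=> S12; apply/eqP; rewrite -subv0; apply/subvP => z.
rewrite memv_cap memv0 => /andP[z1 z2].
have Hz := subvP (coroot_span_cartan S1) z z1.
suff: Subvs Hz = 0 by move/(congr1 vsval)/eqP.
apply: (weights_sep charF simpleL cartanH gradA) => c Ac.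
have tr0 : \sum_(b <- A | b (Subvs Hz) == c (Subvs Hz)) (b (Subvs Hz) : F) * dimF b = 0.
  apply: trace_coroot_span z1 => a b a1 na1 Ab /eqP bc Aab.
  rewrite add_lfunE bc (coroot_orth (closed_split_sym S12) Hz z2 a1 na1) add0r.
  by rewrite eqxx.
apply/eqP; move/eqP: tr0; rewrite (eq_bigr (fun b => (c (Subvs Hz) : F) * dimF b)).
  rewrite -mulr_sumr mulf_eq0 -natr_sum (natf_eq0 charF) => /orP[//|].
  rewrite (big_rem c) //= eqxx addn_eq0 dimv_eq0.
  by rewrite -[rs c == _]negbK -(wg_mem gradA) Ac.
by move=> b /eqP->.
Qed.

Lemma coroot_span_simple S1 S2 : closed_split S1 S2 -> S1 != fset0 -> S2 != fset0 ->
  exists2 c, c \in S1 & - c \notin S1.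
Proof.
move=> S12 S1n0 S2n0.
have [//|noT] := EM (exists2 c, c \in S1 & - c \notin S1).
have sym1 c : c \in S1 -> - c \in S1.
  by move=> c1; apply/negPn/negP => nc1; apply: noT; exists c.
have [rS dS c1 c2] := S12.
have sym2 c : c \in S2 -> - c \in S2.
  move=> c2'; have := root_opp charF simpleL cartanH gradA (split_root2 S12 c2').
  by rewrite rS => /orP[/sym1|//]; rewrite opprK => /dS/(_ c2').
pose I := (coroot_span S1 + \sum_(a <- S1) rs a)%VS.
have Irs a : a \in S1 -> (rs a <= I)%VS.
  by move=> a1; apply: subv_trans (addvSr _ _); rewrite (big_rem a) ?addvSl.
have Ico : (coroot_span S1 <= I)%VS by apply: addvSl.
have idI : is_ideal I.
  apply: (wg_ind gradA (Q := fun x => forall y, y \in I -> [[x, y]] \in I))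
    => [y _|x1 x2 IH1 IH2 y Iy|b x Ab xb].
  - by rewrite lie0l mem0v.
  - by rewrite lieDl memvD ?IH1 ?IH2.
  have I0 y : [[x, y]] = 0 -> [[x, y]] \in I by move=> ->; apply: mem0v.
  have xz z : z \in coroot_span S1 -> [[x, z]] \in I.
    move=> z1; have Hz := subvP (coroot_span_cartan S1) z z1.
    have [b0|b0] := eqVneq b 0.
      apply: I0; apply: (cartan_abelian charF simpleL cartanH gradA) => //.
      by rewrite -(rs0 cartanH gradA) -b0.
    rewrite lie_anti memvN (rsEH Hz xb).
    have := is_root_intro b0 Ab; rewrite rS => /orP[b1|b2].
      by rewrite memvZ // (subvP (Irs b b1)).
    by rewrite (coroot_orth S12 Hz z1 b2 (sym2 b b2)) scale0r mem0v.
  have xm a m : a \in S1 -> m \in rs a -> [[x, m]] \in I.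
    move=> a1 ma; have [b0|b0] := eqVneq b 0.
      have Hx : x \in H by rewrite -(rs0 cartanH gradA) -b0.
      by rewrite (rsEH Hx ma) memvZ // (subvP (Irs a a1)).
    have := is_root_intro b0 Ab; rewrite rS => /orP[b1|b2]; last first.
      apply: I0; apply: (rs_lie0 gradA xb ma).
      exact: (split_lie0 (closed_split_sym S12) b2 (sym2 b b2) a1 (sym1 a a1)).
    have [ba0|ba0] := eqVneq (b + a) 0.
      apply: (subvP Ico); apply: mem_coroot_span b1 (sym1 b b1) xb _.
      by rewrite (addr0_eq ba0).
    have [|nA] := boolP (b + a \in A); last exact/I0/(rs_lie0 gradA xb ma).
    move=> /(is_root_intro ba0) /(c1 _ _ b1 a1) ba1.
    exact: (subvP (Irs _ ba1) _ (rs_lie gradA xb ma)).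
  move=> y /memv_addP[z z1 [m m1 ->] ]; rewrite lieDr memvD //; first exact: xz.
  rewrite -adE memv_preim.
  apply: subvP m1; rewrite big_seq; elim/big_rec: _ => [|a U a1 IHU]; first exact: sub0v.
  rewrite subv_add IHU andbT; apply/subvP => v va.
  by rewrite -memv_preim adE (xm a).
have sepI : forall P : pred (weight H), P 0 -> {in S1, forall a, P a} -> (I <= gpart A rs P)%VS.
  move=> P P0 P1; rewrite subv_add; apply/andP; split.
    have sub0 : (coroot_span S1 <= rs 0%R)%VS.
      by rewrite (rs0 cartanH gradA) coroot_span_cartan.
    apply: subv_trans sub0 _.
    have [->|rs00] := eqVneq (rs 0) 0%VS; first exact: sub0v.
    by apply: gpart_sub P0; rewrite (wg_mem gradA).
  rewrite big_seq; elim/big_rec: _ => [|a U a1 IHU]; first exact: sub0v.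
  rewrite subv_add IHU andbT; apply: gpart_sub (P1 a a1).
  exact/is_root_mem/(split_root1 S12).
have [I0|IT] : I = 0%VS \/ I = fullv by case: simpleL => _; apply.
- have /fset0Pn[a a1] := S1n0.
  have := Irs a a1; rewrite I0 subv0 -[_ == _]negbK -(wg_mem gradA).
  by rewrite (is_root_mem (split_root1 S12 a1)).
have /fset0Pn[b b2] := S2n0.
have Ab := is_root_mem (split_root2 S12 b2).
have /eqP : (gpart A rs (predC1 b) :&: gpart A rs (pred1 b) = 0)%VS.
  by apply: (gpart_capv uA fullA iA) => c _ /= /negPf->.
have -> : gpart A rs (predC1 b) = fullv.
  apply/eqP; rewrite eqEsubv subvf -IT sepI //=.
    by have := split_root2 S12 b2; rewrite (is_rootE gradA) eq_sym => /andP[].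
  move=> a a1; apply: contraTneq a1 => ->; apply/negP => b1.
  exact: dS b1 b2.
by rewrite capfv gpart1 // -[_ == _]negbK -(wg_mem gradA) Ab.
Qed.
End ClosedPartitions.

Section HalfSum.
Variables (F : closedFieldType) (L : lieAlgType F) (H : {vspace L}).
Implicit Types (U V W : {vspace L}) (x y z : L) (a b c : weight H).
Implicit Types (h : subvs_of H) (S : {fset (weight H)}).
Hypothesis charF : [pchar F] =i pred0.
Variable A : seq (weight H).
Hypothesis gradA : weight_grading A (@root_space F L H).
Local Notation rs := (@root_space F L H).
Local Notation "e ^^ n" := (iter n (lie e)) (at level 20, n at level 2).
Local Notation dimF a := ((\dim (rs a))%:R : F).
Variables (T : pred (weight H)) (g : weight H) (e f : L) (h : subvs_of H).
Hypothesis rootT : forall c, T c -> is_root c.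
Hypothesis Tg : T g.
Hypothesis Tng : ~~ T (- g).
Hypothesis T_add : forall c, T c -> is_root (c + g) -> T (c + g).
Hypothesis (eg : e \in rs g) (fg : f \in rs (- g)).
Hypothesis (efh : sl2_triple e f (vsval h)) (gh2 : (g h : F) = 2%:R).

(* c + k g is the reflection of c along g. *)
Lemma reflect_root c k : T c -> (c h : F) = - k%:R ->
  T (c + g *+ k) /\ (\dim (rs c) <= \dim (rs (c + g *+ k)%R))%N.
Proof.
move=> Tc ck.
have rg := rootT Tg.
have inj v : v \in rs c -> e ^^ k v = 0 -> v = 0.
  exact: (root_reflect_inj charF gradA rg eg fg efh ck).
have emem v i : v \in rs c -> e ^^ i v \in rs (c + g *+ i).
  move=> cv; elim: i => [|i IHi]; first by rewrite addr0.
  by rewrite mulrS addrCA; exact: (rs_lie gradA eg IHi).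
split.
  have [v cv v0] := root_nz gradA (is_root_mem gradA (rootT Tc)).
  suff: forall i, (i <= k)%N -> T (c + g *+ i) by apply.
  elim=> [|i IHi] lt_ik; first by rewrite addr0.
  have Ti := IHi (ltnW lt_ik).
  rewrite mulrSr addrA; apply: (T_add Ti).
  apply: (is_root_intro gradA).
    by apply: contraNneq Tng => /addr0_eq<-; rewrite opprK.
  have := emem v i.+1 cv; rewrite mulrSr addrA => /(wg_mem_vec gradA); apply.
  apply: contraNneq v0 => ei0; apply/eqP/inj => //.
  by rewrite -(subnK lt_ik) iterD ei0 iter_lie0.
rewrite -(@limg_dim_eq _ _ _ (lpow (ad e) k)); last first.
  apply/eqP; rewrite -subv0; apply/subvP => v.
  rewrite memv_cap memv_ker memv0 lpowE -iter_lieE => /andP[cv /eqP ev].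
  by apply/eqP/inj.
apply: dimvS; apply/subvP => _ /memv_imgP[v cv ->].
by rewrite lpowE -iter_lieE emem.
Qed.

Lemma half_sum_neq0 : \sum_(c <- A | T c) (c h : F) * dimF c != 0.
Proof.
have rg := rootT Tg.
have uA := wg_uniq gradA.
have /choice[z zP] : forall c, exists k : int, c \in A -> (c h : F) = k%:~R.
  move=> c; have [Ac|nAc] := boolP (c \in A); last by exists 0.
  have [k kP] := root_integral charF gradA rg eg fg efh Ac.
  by exists k.
have TA c : T c -> c \in A by move/rootT/(is_root_mem gradA).
pose w c := (\dim (rs c) * `|z c|)%N.
pose Xp := (\sum_(c <- A | T c && (0 < z c)%R) w c)%N.
pose Xm := (\sum_(c <- A | T c && (z c < 0)%R) w c)%N.
have -> : \sum_(c <- A | T c) (c h : F) * dimF c = Xp%:R - Xm%:R.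
  rewrite !natr_sum !big_mkcondr /= -sumrB.
  rewrite big_seq_cond [RHS]big_seq_cond; apply: eq_bigr => c /andP[Ac _].
  rewrite (zP c Ac) /w; case: (z c) => [ [|n]|n] /=.
  - by rewrite mul0r subrr.
  - by rewrite subr0 natrM mulrC.
  - by rewrite sub0r natrM mulrC NegzE mulrNz mulrN.
have zg : z g = 2 by apply: (intf_inj charF); rewrite -zP ?TA.
pose s c := c + g *+ `|z c|.
have sP c : T c -> z c < 0 ->
    [/\ T (s c), (\dim (rs c) <= \dim (rs (s c)))%N & z (s c) = `|z c|%N].
  move=> Tc zc; have ck : (c h : F) = - `|z c|%:R.
    by rewrite zP ?TA // pmulrn (ltz0_abs zc) mulrNz opprK.
  have [Ts dimS] := reflect_root Tc ck; split=> //.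
  apply: (intf_inj charF); rewrite -zP ?TA // add_lfunE weight_mulrn ck gh2 -pmulrn.
  by ring.
pose R := [seq c <- A | T c && (z c < 0)].
pose R' := [seq c <- A | T c && (0 < z c)].
have RP c : c \in R -> T c /\ z c < 0 by rewrite mem_filter => /andP[/andP[] ].
have uR : uniq (map s R).
  rewrite map_inj_in_uniq ?filter_uniq // => c d /RP[Tc zc] /RP[Td zd] scd.
  have [_ _ zsc] := sP c Tc zc; have [_ _ zsd] := sP d Td zd.
  move: zsc; rewrite scd zsd => -[zcd]; move: scd; rewrite /s zcd; exact: addIr.
have R'g : g \in R' by rewrite mem_filter /= Tg zg TA.
have uR' : uniq R' by rewrite filter_uniq.
have ltX : (Xm < Xp)%N.
  rewrite /Xp /Xm -big_filter -[X in (_ < X)%N]big_filter -/R -/R'.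
  have wg : w g = (\dim (rs g) * 2)%N by rewrite /w zg.
  rewrite [X in (_ < X)%N](bigD1_seq g) //= wg.
  have dg : (0 < \dim (rs g))%N by rewrite lt0n dimv_eq0 -(wg_mem gradA) TA.
  apply: leq_ltn_trans (_ : (\sum_(c <- R' | c != g) w c < _)%N); last first.
    by rewrite -[X in (X < _)%N]add0n ltn_add2r muln_gt0 dg.
  apply: leq_trans (_ : (\sum_(c <- map s R) w c <= _)%N).
    rewrite big_map big_seq [X in (_ <= X)%N]big_seq; apply: leq_sum => c /RP[Tc zc].
    by have [_ dimS zs] := sP c Tc zc; rewrite /w /= zs leq_mul2r dimS orbT.
  rewrite -[X in (_ <= X)%N]big_filter; apply: (uniq_sub_le_big leqnn) => //.
  - by move=> m n; apply: leq_addr.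
  - by rewrite filter_uniq.
  move=> _ /mapP[c /RP[Tc zc] ->]; have [Ts dimS zs] := sP c Tc zc.
  rewrite mem_filter; apply/andP; split.
    apply: contraNneq Tng => sg; move: zs; rewrite sg zg => -[k2].
    move: sg; rewrite /s -k2 mulr2n => /eqP; rewrite addrA -subr_eq0 addrK.
    by rewrite addr_eq0 => /eqP<-.
  rewrite mem_filter Ts zs TA //= andbT ltz_nat lt0n absz_eq0.
  by apply: contraTneq zc => ->.
by rewrite -natrB ?(ltnW ltX) // (natf_eq0 charF) subn_eq0 -ltnNge.
Qed.
End HalfSum.

Lemma big_ord2 (R : Type) (idx : R) (op : Monoid.law idx) (f : 'I_2 -> R) :
  \big[op/idx]_(i < 2) f i = op (f ord0) (f ord_max).
Proof.
by rewrite big_ord_recr big_ord1; congr (op (f _) _); apply: val_inj.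
Qed.

Lemma ord2_ind (Q : 'I_2 -> Prop) : Q ord0 -> Q ord_max -> forall i, Q i.
Proof.
move=> Q0 Q1 [ [|[|//] ] lti].
  by rewrite (_ : Ordinal lti = ord0) //; apply: val_inj.
by rewrite (_ : Ordinal lti = ord_max) //; apply: val_inj.
Qed.

Section RegularDecomposition.
Variables (F : closedFieldType) (L : lieAlgType F) (H : {vspace L}).
Implicit Types (U V W : {vspace L}) (x y z : L) (a b c : weight H).
Implicit Types (h : subvs_of H) (S : {fset (weight H)}).
Hypothesis charF : [pchar F] =i pred0.
Hypothesis simpleL : is_simple L.
Hypothesis cartanH : is_cartan H.
Variable A : seq (weight H).
Hypothesis gradA : weight_grading A (@root_space F L H).
Local Notation rs := (@root_space F L H).
Local Notation dimF a := ((\dim (rs a))%:R : F).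
Let fullA := wg_full gradA.
Let uA := wg_uniq gradA.
Let iA := wg_indep cartanH gradA.

Lemma coroot_span_proper S1 S2 : closed_split S1 S2 ->
  S1 != fset0 -> S2 != fset0 -> (coroot_span S1 + coroot_span S2)%VS != H.
Proof.
move=> S12 S1n0 S2n0; apply/eqP => spanH.
have [g g1 ng1] := coroot_span_simple charF simpleL cartanH gradA S12 S1n0 S2n0.
have [rS dS c1 c2] := S12.
have S21 := closed_split_sym S12.
pose T c := (c \in S1) && (- c \notin S1).
have opp a : is_root a -> is_root (- a) by apply: (root_opp charF simpleL cartanH gradA).
have subK a b : a + b + - a = b by rewrite addrAC subrr add0r.
have r1 a : a \in S1 -> is_root a by apply: (split_root1 S12).
have r2 a : a \in S2 -> is_root a by apply: (split_root2 S12).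
have T_add a c : a \in S1 -> T c -> a + c \in A -> T (a + c).
  move=> a1 /andP[sc1 nc1] Aac.
  have ac0 : a + c != 0.
    apply: contraNneq nc1 => /eqP; rewrite addr_eq0 => /eqP ac.
    by rewrite -ac.
  have rac := is_root_intro gradA ac0 Aac.
  have ac1 := c1 _ _ a1 sc1 rac.
  apply/andP; split=> //; apply: contra nc1 => nac1.
  have := c1 _ _ nac1 a1; rewrite opprD addrAC addNr add0r; apply.
  exact/opp/r1.
have stab1 a c : a \in S1 -> - a \in S1 -> c \in A -> T c -> a + c \in A -> T (a + c).
  by move=> a1 _ _; apply: T_add.
have stab2 a c : a \in S2 -> - a \in S2 -> c \in A -> T c -> a + c \in A -> T (a + c).
  move=> a2 na2 _ /andP[sc1 nc1] Aac.
  have ac0 : a + c != 0.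
    by apply/eqP => /addr0_eq ac; apply: (dS c) => //; rewrite -ac.
  have rac := is_root_intro gradA ac0 Aac.
  have ac1 : a + c \in S1.
    have := rac; rewrite rS => /orP[//|ac2].
    case: (dS c) => //; have := c2 _ _ ac2 na2; rewrite subK; apply.
    exact: r1.
  apply/andP; split=> //; apply/negP => nac1.
  apply: (dS (- a)) => //; have := c1 _ _ nac1 sc1; rewrite opprD addrNK; apply.
  exact: r2.
have Tg : T g by rewrite /T g1 ng1.
have Tng : ~~ T (- g) by rewrite /T opprK g1 andbF.
have rootT c : T c -> is_root c by case/andP=> /r1.
have T_addg c : T c -> is_root (c + g) -> T (c + g).
  by rewrite addrC => Tc /(is_root_mem gradA); apply: T_add.
have [e [f [h [eg fg efh gh] ] ] ] := root_sl2 charF simpleL cartanH gradA (r1 g g1).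
have := half_sum_neq0 charF gradA rootT Tg Tng T_addg eg fg efh gh.
have : vsval h \in (coroot_span S1 + coroot_span S2)%VS by rewrite spanH subvsP.
case/memv_addP=> z1 z1S [z2 z2S zE].
have Hz1 := subvP (coroot_span_cartan cartanH gradA S1) z1 z1S.
have Hz2 := subvP (coroot_span_cartan cartanH gradA S2) z2 z2S.
have -> : h = Subvs Hz1 + Subvs Hz2 by apply: val_inj.
rewrite (eq_bigr (fun c => (c (Subvs Hz1) : F) * dimF c + (c (Subvs Hz2) : F) * dimF c)).
  rewrite big_split /= (trace_coroot_span cartanH gradA Hz1 stab1 z1S).
  by rewrite (trace_coroot_span cartanH gradA Hz2 stab2 z2S) addr0 eqxx.
by move=> c _; rewrite linearD mulrDl.
Qed.

Lemma perm_roots S : (forall a, a \in S -> is_root a) ->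
  perm_eq S (filter (mem S) A).
Proof.
move=> rootS; apply: uniq_perm; rewrite ?fset_uniq ?filter_uniq // => a.
rewrite mem_filter; case Sa: (a \in S); rewrite /= ?Sa //.
by rewrite (is_root_mem gradA) ?rootS.
Qed.

Lemma sum_rsE S : (forall a, a \in S -> is_root a) ->
  (\sum_(a <- S) rs a)%VS = gpart A rs (mem S).
Proof.
by move=> /perm_roots pS; rewrite /gpart -[RHS]big_filter; apply: perm_big.
Qed.

Lemma cartan_gpart U (P : pred (weight H)) : (U <= H)%VS -> ~~ P 0 ->
  (U :&: gpart A rs P = 0)%VS.
Proof.
move=> UH P0; apply/eqP; rewrite -subv0.
have UH0 : (U <= gpart A rs (pred1 0%R))%VS.
  have UH' : (U <= rs 0%R)%VS by rewrite (rs0 cartanH gradA).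
  apply: subv_trans UH' _.
  have [->|rs0n0] := eqVneq (rs 0) 0%VS; first exact: sub0v.
  by apply: gpart_sub; rewrite /= ?eqxx // (wg_mem gradA).
have cap0 : (gpart A rs (pred1 0%R) :&: gpart A rs P = 0)%VS.
  by apply: (gpart_capv uA fullA iA) => c _ /eqP-> P0'; rewrite P0' in P0.
by rewrite -cap0 capvS ?subvv.
Qed.

Lemma root_set0 S : (forall a, a \in S -> is_root a) -> ~~ (mem S) 0.
Proof.
move=> rootS; apply/negP => /rootS; rewrite /is_root eqxx.
by [].
Qed.

Lemma regular_form U S : (U <= H)%VS -> (forall a, a \in S -> is_root a) ->
  has_regular_form (regular_space U S) U S.
Proof.
move=> UH rootS; split=> //.
  by apply/fsubsetP => a /rootS; rewrite mem_root_system.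
rewrite directvE /= dimv_disjoint_sum; last first.
  by rewrite sum_rsE // cartan_gpart // root_set0.
rewrite sum_rsE // (gpart_dim uA fullA iA) eqn_add2l -big_filter.
by apply/eqP/esym/perm_big/perm_roots.
Qed.

Lemma lie_regular_space U S : (U <= H)%VS -> (coroot_span S <= U)%VS ->
    (forall a, a \in S -> is_root a) ->
    (forall a b, a \in S -> b \in S -> is_root (a + b) -> a + b \in S) ->
  is_subalgebra (regular_space U S).
Proof.
move=> UH SU rootS closedS; set R := regular_space U S.
have sU z : z \in U -> z \in R by apply: (subvP (addvSl _ _)).
have sR a z : a \in S -> z \in rs a -> z \in R.
  move=> Sa za; apply: (subvP (addvSr _ _)); rewrite (big_rem a) //=.
  exact: (subvP (addvSl _ _)).
have RP (Q : L -> Prop) : (forall z, z \in U -> Q z) ->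
    (forall a z, a \in S -> z \in rs a -> Q z) ->
    (forall z w, Q z -> Q w -> Q (z + w)) -> forall z, z \in R -> Q z.
  move=> QU QS QD z /memv_addP[u uU [m mS ->] ]; apply: (QD _ _ (QU u uU)).
  have : m \in (\sum_(a <- S | a \in S) rs a)%VS by rewrite -big_seq.
  have Q0 : Q 0 by apply/QU/mem0v.
  elim/big_rec: _ m {mS} => [|a V Sa IHV] m; first by rewrite memv0 => /eqP->.
  by case/memv_addP=> v va [w /IHV Qw ->]; apply: QD => //; apply: QS va.
move=> x y xR yR; move: x xR; apply: (RP (fun x => [[x, y]] \in R)) => [x xU|a x Sa xa|x1 x2 IH1 IH2]; last first.
- by rewrite lieDl memvD.
- move: y yR; apply: (RP (fun y => [[x, y]] \in R)) => [y yU|b y Sb yb|y1 y2 IH1 IH2]; last first.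
  + by rewrite lieDr memvD.
  + have [ab0|ab0] := eqVneq (a + b) 0.
      apply/sU/(subvP SU)/(mem_coroot_span Sa _ xa).
        by rewrite (addr0_eq ab0).
      by rewrite (addr0_eq ab0).
    have [Aab|nA] := boolP (a + b \in A); last by rewrite (rs_lie0 gradA xa yb nA) mem0v.
    apply: sR (rs_lie gradA xa yb); apply: closedS => //.
    exact: (is_root_intro gradA ab0 Aab).
  rewrite lie_anti memvN (rsEH (subvP UH y yU) xa) memvZ //.
  exact: sR xa.
move: y yR; apply: (RP (fun y => [[x, y]] \in R)) => [y yU|b y Sb yb|y1 y2 IH1 IH2].
- by rewrite (cartan_abelian charF simpleL cartanH gradA) ?mem0v ?(subvP UH).
- by rewrite (rsEH (subvP UH x xU) yb) memvZ //; apply: sR yb.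
- by rewrite lieDr memvD.
Qed.

Lemma regular_data (s : 'I_2 -> {vspace L}) (D : 'I_2 -> {fset (weight H)}) :
    closed_split (D ord0) (D ord_max) -> D ord0 != fset0 -> D ord_max != fset0 ->
    (s ord0 + s ord_max)%VS = H -> (s ord0 :&: s ord_max = 0)%VS ->
    (forall i, (coroot_span (D i) <= s i)%VS) ->
  regular_decomposition_data s D.
Proof.
move=> DD D0 D1 sH s0 cs; have [rD dD c0 c1] := DD.
have sub_s i : (s i <= H)%VS by move: i; apply: ord2_ind; rewrite -sH ?addvSl ?addvSr.
have rootD i a : a \in D i -> is_root a.
  by move: i; apply: ord2_ind => Da; rewrite rD Da ?orbT.
have D_neq0 i : D i != fset0 by move: i; apply: ord2_ind.
have closedD i a b : a \in D i -> b \in D i -> is_root (a + b) -> a + b \in D i.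
  by move: i; apply: ord2_ind; [apply: c0 | apply: c1].
have formD i : has_regular_form (regular_space (s i) (D i)) (s i) (D i).
  exact: regular_form (sub_s i) (@rootD i).
have rs_sub i a : a \in D i -> (rs a <= regular_space (s i) (D i))%VS.
  move=> Da; apply: subv_trans (addvSr _ _); rewrite (big_rem a) //=.
  exact: addvSl.
have sumD : (\sum_i regular_space (s i) (D i))%VS = fullv.
  apply/eqP; rewrite eqEsubv subvf -fullA big_seq /=.
  elim/big_rec: _ => [|a U Aa IHU]; first exact: sub0v.
  rewrite subv_add IHU andbT; have [->|a0] := eqVneq a 0.
    have rs0s : (rs 0%R <= s ord0 + s ord_max)%VS by rewrite (rs0 cartanH gradA) sH.
    apply: subv_trans rs0s _; rewrite subv_add.
    by apply/andP; split; [apply: (sumv_sup ord0) | apply: (sumv_sup ord_max)] => //;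
       apply: addvSl.
  have := is_root_intro gradA a0 Aa; rewrite rD => /orP[Da|Da].
    by apply: (sumv_sup ord0) => //; apply: rs_sub.
  by apply: (sumv_sup ord_max) => //; apply: rs_sub.
have subD i : is_subalgebra (regular_space (s i) (D i)).
  exact: lie_regular_space (sub_s i) (cs i) (@rootD i) (@closedD i).
have capD : (regular_space (s ord0) (D ord0) :&: regular_space (s ord_max) (D ord_max) = 0)%VS.
  apply/eqP; rewrite -subv0; apply/subvP => x; rewrite memv_cap memv0.
  case/andP=> /memv_addP[u0 u0s [m0 m0D xE] ] /memv_addP[u1 u1s [m1 m1D xE'] ].
  have mD i m : m \in (\sum_(a <- D i) rs a)%VS -> m \in gpart A rs (predC1 0).
    rewrite sum_rsE; last exact: rootD.
    apply/subvP/gpart_mono => a _ /= Da.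
    by have := rootD i a Da; rewrite (is_rootE gradA) => /andP[].
  have um : u0 - u1 = m1 - m0.
    by apply/eqP; rewrite subr_eq addrAC -subr_eq opprK -xE xE' addrC.
  have /eqP um0 : u0 - u1 == 0.
    rewrite -memv0 -(@cartan_gpart H (predC1 0)) ?subvv /= ?eqxx // memv_cap.
    rewrite memvB ?(subvP (sub_s _) _ u0s) ?(subvP (sub_s _) _ u1s) //= um.
    by rewrite memvB ?(mD _ _ m0D) ?(mD _ _ m1D).
  have m01 : m0 = m1 by apply/esym/eqP; rewrite -subr_eq0 -um um0.
  have u0_0 : u0 = 0.
    apply/eqP; rewrite -memv0 -s0 memv_cap u0s; move/eqP: um0.
    by rewrite subr_eq0 => /eqP->.
  have m0_0 : m0 = 0.
    apply/eqP; rewrite -memv0.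
    have <- : (gpart A rs (mem (D ord0)) :&: gpart A rs (mem (D ord_max)) = 0)%VS.
      by apply: (gpart_capv uA fullA iA) => a _; apply: dD.
    rewrite memv_cap -!sum_rsE ?m0D; [|exact: rootD|exact: rootD].
    by rewrite m01.
  by rewrite xE u0_0 m0_0 addr0.
split=> //; split=> //.
- split=> //; rewrite directvE /= !big_ord2 /=.
  by rewrite dimv_disjoint_sum.
- move=> i; have /fset0Pn[a Da] := D_neq0 i.
  have [v va v0] := root_nz gradA (is_root_mem gradA (rootD i a Da)).
  apply: contraNneq v0 => g0; rewrite -memv0 -g0.
  exact: (subvP (rs_sub i a Da)).
- move=> i j nij; suff -> : (regular_space (s i) (D i) + regular_space (s j) (D j))%VS = fullv.
    by move=> *; apply: memvf.
  rewrite -sumD big_ord2; move: i j nij; apply: ord2_ind; apply: ord2_ind => //.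
  by rewrite addvC.
- by move=> i; exists (s i), (D i).
Qed.

Lemma closed_partitionP S1 S2 : closed_partition S1 S2 <->
  [/\ closed_split S1 S2, S1 != fset0 & S2 != fset0].
Proof.
split=> [ [U12 d12 [S1n0 S2n0] [c1 c2] ]|[ [rS dS c1 c2] S1n0 S2n0] ].
  split=> //; split=> [a|a a1 a2|a b a1 b1|a b a2 b2].
  - by rewrite -mem_root_system -U12 in_fsetU.
  - by have /fdisjointP/(_ a a1) := d12; rewrite a2.
  - by rewrite -mem_root_system; apply: c1.
  - by rewrite -mem_root_system; apply: c2.
split=> //.
- by apply/fsetP => a; rewrite in_fsetU mem_root_system rS.
- by apply/fdisjointP => a a1; apply/negP; apply: dS.
- by split=> a b a1 b1; rewrite mem_root_system; [apply: c1 | apply: c2].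
Qed.

Lemma closed_partition_regular (D : 'I_2 -> {fset (weight H)}) :
    closed_partition (D ord0) (D ord_max) ->
  exists s t : 'I_2 -> {vspace L},
    [/\ regular_decomposition_data s D, regular_decomposition_data t D
      & exists i, s i <> t i].
Proof.
case/closed_partitionP=> DD D0 D1.
have hsub i : (coroot_span (D i) <= H)%VS := coroot_span_cartan cartanH gradA (D i).
set h0 := coroot_span (D ord0); set h1 := coroot_span (D ord_max).
pose C : {vspace L} := (H :\: (h0 + h1))%VS.
have sumC : (C + (h0 + h1) = H)%VS.
  by rewrite addv_diff; apply/addv_idPl; rewrite subv_add !hsub.
have capC : (C :&: (h0 + h1) = 0)%VS := capv_diff _ _.
have cap01 : (h0 :&: h1 = 0)%VS := coroot_span_cap charF simpleL cartanH gradA DD.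
have C0 : C != 0%VS.
  rewrite diffv_eq0; apply: contraNN (coroot_span_proper DD D0 D1) => Hsub.
  by rewrite eqEsubv subv_add !hsub.
have capC01 (U V : {vspace L}) : (U + V = h0 + h1)%VS -> (U :&: V = 0)%VS ->
    ((U + C) :&: V = 0)%VS.
  move=> UV capUV; apply/eqP; rewrite -subv0; apply/subvP => x.
  rewrite memv_cap memv0 => /andP[/memv_addP[u Uu [c Cc xE] ] Vx].
  have c0 : c = 0.
    apply/eqP; rewrite -memv0 -capC memv_cap Cc -UV.
    have -> : c = - u + x by rewrite xE addKr.
    by rewrite memv_add ?memvN.
  by rewrite -memv0 -capUV memv_cap Vx andbT xE c0 addr0.
exists (fun i => if i == ord0 then h0 + C else h1)%VS.
exists (fun i => if i == ord0 then h0 else h1 + C)%VS.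
split.
- apply: regular_data => //=.
  + by rewrite -sumC [RHS]addvC -!addvA [X in (_ + X)%VS]addvC.
  + exact: capC01.
  + by apply: ord2_ind => /=; rewrite ?addvSl ?subvv.
- apply: regular_data => //=.
  + by rewrite -sumC [RHS]addvC addvA.
  + by rewrite capvC; apply: capC01; rewrite 1?addvC // capvC.
  + by apply: ord2_ind => /=; rewrite ?addvSl ?subvv.
exists ord0 => /= eq0; move/eqP: C0; apply; apply/eqP.
rewrite -subv0 -capC subv_cap subvv /=.
by apply: subv_trans (addvSr h0 C) _; rewrite eq0 addvSl.
Qed.

Lemma regular_closed_partition (g s : 'I_2 -> {vspace L})
    (D : 'I_2 -> {fset (weight H)}) :
    regular_decomposition H g ->
    (forall i, has_regular_form (g i) (s i) (D i)) ->
  closed_partition (D ord0) (D ord_max).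
Proof.
move=> [ [_ sumg dirg] g0 subg _ _] formg.
have rootD i a : a \in D i -> is_root a.
  by case: (formg i) => _ /fsubsetP sD _ _ /sD; rewrite mem_root_system.
have gE i : g i = regular_space (s i) (D i) by case: (formg i).
have sub_s i : (s i <= H)%VS by case: (formg i).
have rs_sub i a : a \in D i -> (rs a <= g i)%VS.
  move=> Da; rewrite gE; apply: subv_trans (addvSr _ _); rewrite (big_rem a) //=.
  exact: addvSl.
have capg i j : i != j -> (g i :&: g j = 0)%VS.
  have cap01 : (g ord0 :&: g ord_max = 0)%VS.
    apply/directv_addP; move: dirg; rewrite !directvE /= !big_ord2 /=.
    by [].
  move: i j; apply: ord2_ind; apply: ord2_ind => // _.
  by rewrite capvC.
have dD a : a \in D ord0 -> a \in D ord_max -> False.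
  move=> Da0 Da1; have [v va v0] := root_nz gradA (is_root_mem gradA (rootD _ a Da0)).
  case/eqP: v0; apply/eqP; rewrite -memv0 -(capg ord0 ord_max) // memv_cap.
  by rewrite (subvP (rs_sub _ _ Da0)) ?(subvP (rs_sub _ _ Da1)).
have rD a : is_root a = (a \in D ord0) || (a \in D ord_max).
  apply/idP/orP => [ra|[] ]; try exact: rootD.
  apply/orP; apply: contraT; rewrite negb_or => /andP[Da0 Da1].
  have Aa := is_root_mem gradA ra.
  have /eqP : (gpart A rs (predC1 a) :&: gpart A rs (pred1 a) = 0)%VS.
    by apply: (gpart_capv uA fullA iA) => c _ /= /negPf->.
  suff -> : gpart A rs (predC1 a) = fullv.
    by rewrite capfv gpart1 // -[_ == _]negbK -(wg_mem gradA) Aa.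
  have subP i : a \notin D i -> (g i <= gpart A rs (predC1 a))%VS.
    move=> Da; rewrite gE subv_add; apply/andP; split; last first.
      rewrite sum_rsE; last exact: rootD.
      by apply: gpart_mono => c _ /= Dc; apply: contraNneq Da => <-.
    have sH : (s i <= rs 0%R)%VS by rewrite (rs0 cartanH gradA).
    apply: subv_trans sH _.
    have [->|rs00] := eqVneq (rs 0) 0%VS; first exact: sub0v.
    apply: gpart_sub; first by rewrite (wg_mem gradA).
    by move: ra; rewrite (is_rootE gradA) eq_sym => /andP[].
  by apply/eqP; rewrite eqEsubv subvf -sumg big_ord2 subv_add !subP.
have closedD i j a b : i != j -> (forall c, is_root c -> c \in D i \/ c \in D j) ->
    a \in D i -> b \in D i -> is_root (a + b) -> a + b \in D i.
  move=> nij rDij Da Db rab; have [//|Dab] := rDij _ rab.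
  have [x [y [xa yb xy0] ] ] := root_lie_neq0 charF simpleL cartanH gradA
    (rootD i a Da) (rootD i b Db) rab.
  case/eqP: xy0; apply/eqP; rewrite -memv0 -(capg i j nij) memv_cap subg.
  - exact: (subvP (rs_sub j _ Dab) _ (rs_lie gradA xa yb)).
  - exact: (subvP (rs_sub i a Da)).
  - exact: (subvP (rs_sub i b Db)).
have D_neq0 i j : i != j -> (forall c, is_root c -> c \in D i \/ c \in D j) -> D i != fset0.
  move=> nij rDij; apply/eqP => Di0.
  have Dj c : is_root c -> (rs c <= g j)%VS.
    by move=> rc; apply: rs_sub; case: (rDij c rc); rewrite ?Di0 ?inE.
  suff gT : g j = fullv.
    by have := g0 i; rewrite -(capfv (g i)) -gT capvC capg ?eqxx.
  apply: (simple_perfect simpleL) => x y.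
  move: x; apply: (wg_ind gradA) => [|x1 x2 x1E x2E|a x Aa xa].
  - by rewrite lie0l mem0v.
  - by rewrite lieDl memvD.
  move: y; apply: (wg_ind gradA) => [|y1 y2 y1E y2E|b y Ab yb].
  - by rewrite lie0r mem0v.
  - by rewrite lieDr memvD.
  have HE z : z \in rs 0 -> z \in H by rewrite (rs0 cartanH gradA).
  have [a0|a0] := eqVneq a 0; have [b0|b0] := eqVneq b 0.
  - rewrite (cartan_abelian charF simpleL cartanH gradA) ?mem0v //.
      by apply: HE; rewrite -a0.
    by apply: HE; rewrite -b0.
  - have Hx : x \in H by apply: HE; rewrite -a0.
    rewrite (rsEH Hx yb) memvZ //.
    exact: (subvP (Dj b (is_root_intro gradA b0 Ab))).
  - have Hy : y \in H by apply: HE; rewrite -b0.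
    rewrite lie_anti memvN (rsEH Hy xa) memvZ //.
    exact: (subvP (Dj a (is_root_intro gradA a0 Aa))).
  - apply: subg; first exact: (subvP (Dj a (is_root_intro gradA a0 Aa))).
    exact: (subvP (Dj b (is_root_intro gradA b0 Ab))).
have rD01 c : is_root c -> c \in D ord0 \/ c \in D ord_max by rewrite rD => /orP.
have rD10 c : is_root c -> c \in D ord_max \/ c \in D ord0 by rewrite rD orbC => /orP.
apply/closed_partitionP; split.
- split=> [//|//|a b|a b]; first exact: (closedD ord0 ord_max a b isT rD01).
  exact: (closedD ord_max ord0 a b isT rD10).
- exact: (D_neq0 ord0 ord_max isT rD01).
- exact: (D_neq0 ord_max ord0 isT rD10).
Qed.

End RegularDecomposition.

Theorem proposition2p1 (F : closedFieldType) (charF : [pchar F] =i pred0)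
    (L : lieAlgType F) (simpleL : is_simple L)
    (H : {vspace L}) (cartanH : is_cartan H) :
  (forall D : 'I_2 -> {fset (weight H)},
     closed_partition (D ord0) (D ord_max) ->
     exists s t : 'I_2 -> {vspace L},
       [/\ regular_decomposition_data s D,
           regular_decomposition_data t D &
           exists i, s i <> t i])
  /\
  (forall (g s : 'I_2 -> {vspace L}) (D : 'I_2 -> {fset (weight H)}),
     regular_decomposition H g ->
     (forall i, has_regular_form (g i) (s i) (D i)) ->
     closed_partition (D ord0) (D ord_max)).
Proof.
have [A gradA] := root_grading charF simpleL cartanH.
split=> [D|g s D]; first exact: closed_partition_regular gradA D.
exact: regular_closed_partition gradA g s D.
Qed.
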